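(* Let $\mathfrak g''=SKO''(n,n+1;\lambda,\underline t)$ and $\mathfrak g'=[\mathfrak g'',\mathfrak g'']$. If $n\lambda+1\ne0$ in $\mathbb F$ or $\mathfrak S_0(\lambda,n)\neq\emptyset$, then $$\mathfrak g''=\mathfrak g'\oplus\mathrm{span}_{\mathbb F}S_5\oplus\sum_{r\in\mathfrak S_2(\lambda,n),\ (i_1,\dots,i_r)\in\mathbf J(r)}\mathbb F\,D_{KO}(X(i_1,\dots,i_r)).$$ If $n\lambda+1=0$ in $\mathbb F$ and $\mathfrak S_0(\lambda,n)=\emptyset$, then $$\mathfrak g''=\mathfrak g'\oplus\mathrm{span}_{\mathbb F}S_5\oplus\sum_{r\in\mathfrak S_2(\lambda,n),\ (i_1,\dots,i_r)\in\mathbf J(r)}\mathbb F\,D_{KO}(X(i_1,\dots,i_r))\oplus\mathbb F G.$$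
   Context: Setting. $\mathbb F$ is a field of characteristic $p>3$, $n\ge 3$ is an integer, $\underline t=(t_1,\dots,t_n)$ is a tuple of positive integers, $\lambda\in\mathbb F$. Put $\pi_i=p^{t_i}-1$, $\pi=(\pi_1,\dots,\pi_n)$, $\mathbb A=\{\alpha\in\mathbb N_0^n:\alpha_i\le\pi_i\ \forall i\}$, $|\alpha|=\sum_i\alpha_i$, and let $\varepsilon_i$ be the $i$-th unit vector. $\mathcal O(n;\underline t)$ is the divided power algebra with basis $x^{(\alpha)}$, $\alpha\in\mathbb A$, and product $x^{(\alpha)}x^{(\beta)}=\binom{\alpha+\beta}{\alpha}x^{(\alpha+\beta)}$ (with $x^{(\gamma)}=0$ if $\gamma\notin\mathbb A$); $x_i:=x^{(\varepsilon_i)}$. $\mathcal O=\mathcal O(n;\underline t)\otimes\Lambda$, where $\Lambda$ is the exterior superalgebra in odd variables $x_{n+1},\dots,x_{2n+1}$; $\mathrm p(a)\in\mathbb Z_2$ is the parity, and formulas involving $\mathrm p(a)$ are stated for homogeneous $a$ and extended linearly. $\partial_r$ ($1\le r\le 2n+1$) is the superderivation of $\mathcal O$ (even for $r\le n$, odd for $r>n$) with $\partial_r(x^{(\alpha)})=x^{(\alpha-\varepsilon_r)}$ for $r\le n$ and $\partial_r(x_s)=\delta_{rs}$. Put $i'=i+n$ for $1\le i\le n$, $i'=i-n$ for $n+1\le i\le 2n$; $\mu(i)=0$ for $i\le n$ and $\mu(i)=1$ for $n+1\le i\le 2n+1$; $\mathfrak D=\sum_{i=1}^{2n}x_i\partial_i$;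 $\Delta_i=\partial_i\partial_{i'}$ and $\Delta=\sum_{i=1}^n\Delta_i$. For $a\in\mathcal O$ let $T_H(a)=\sum_{i=1}^{2n}(-1)^{\mu(i')\mathrm p(a)}\partial_{i'}(a)\partial_i$, $D_{KO}(a)=T_H(a)+(-1)^{\mathrm p(a)}\partial_{2n+1}(a)\mathfrak D+(\mathfrak D(a)-2a)\partial_{2n+1}$, and $\mathrm{div}_\lambda(a)=(-1)^{\mathrm p(a)}2\big(\Delta(a)+(\mathfrak D-n\lambda\,\mathrm{id})\partial_{2n+1}(a)\big)$. Then $KO(n,n+1;\underline t)=\{D_{KO}(a):a\in\mathcal O\}$ is a Lie superalgebra of superderivations of $\mathcal O$, and $\mathfrak g''=SKO''(n,n+1;\lambda,\underline t)=\{D_{KO}(a):a\in\mathcal O,\ \mathrm{div}_\lambda(a)=0\}$ is a subalgebra. Monomial notation. $x^{(\alpha)}x^u$ always means $\alpha\in\mathbb A$ and $u=\langle i_1,\dots,i_k\rangle$ with $n+1\le i_1<\dots<i_k\le 2n$, $k\ge0$, $x^u=x_{i_1}\cdots x_{i_k}$, $|u|=k$; $u-v$ denotes the increasing sequence with underlying set $u\setminus v$. $\mathrm{zd}(x^{(\alpha)}x^u)=|\alpha|+|u|$. For $1\le i,j\le n$: $\nabla_i(x^{(\alpha)}x^u)=x^{(\alpha+\varepsilon_i)}x_{i'}x^u$ (linear; zero if $\alpha_i=\pi_i$), $\Gamma_i^j=\nabla_j\Delta_i$. $I(\alpha,u)=\{1\le i\le n:\Delta_i(x^{(\alpha)}x^u)\ne0\}$,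 $\widetilde I(\alpha,u)=\{1\le i\le n:\nabla_i(x^{(\alpha)}x^u)\neq0\}$. $S_5=\{D_{KO}(x^{(\alpha)}x^ux_{2n+1}): I(\alpha,u)=\widetilde I(\alpha,u)=\emptyset,\ n\lambda-\mathrm{zd}(x^{(\alpha)}x^u)=0\text{ in }\mathbb F\}$. For an integer $l$, $\mathfrak S_l(\lambda,n)=\{k\in\{0,1,\dots,n\}: n\lambda-n+2k+l=0\text{ in }\mathbb F\}$. $\mathbf J(r)$ is the set of $(i_1,\dots,i_r)$ with $1\le i_1<\dots<i_r\le n$ (for $r=0$ only the empty tuple), and $X(i_1,\dots,i_r)=x^{(\pi_{i_1}\varepsilon_{i_1}+\dots+\pi_{i_r}\varepsilon_{i_r})}x^{\langle1',\dots,n'\rangle-\langle i_1',\dots,i_r'\rangle}$. The sum over $X(i_1,\dots,i_r)$ is the span of the corresponding elements. $G=D_{KO}\big(A\,x_{2n+1}+B\big)$, where, with $\alpha=\pi-\varepsilon_1$ and $u=\langle2',\dots,n'\rangle$, $A=x^{(\alpha)}x^u-\sum_{i\in I(\alpha,u)}\Gamma_i^1(x^{(\alpha)}x^u)$ and $B=(-1)^{|u|}(n\lambda-\mathrm{zd}(x^{(\alpha)}x^u))\nabla_1(x^{(\alpha)}x^u)$. *)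

(* Defs.v *)
From HB Require Import structures.
From mathcomp Require Import all_boot all_order all_algebra.

Set Implicit Arguments.
Unset Strict Implicit.
Unset Printing Implicit Defensive.

Import GRing.Theory.
Local Open Scope ring_scope.

Section OddContact.

Variables (F : fieldType) (p n : nat) (t : 'I_n -> nat) (lam : F).

(* The multi-indices alpha with alpha_i <= p ^ t_i - 1. *)
Definition mindex := {dffun forall i : 'I_n, 'I_(p ^ t i)}.

(* Variables are numbered from 0: the set u : {set 'I_n.+1} encodes the product,
   in increasing order, of the x_(n + 1 + j) for j in u, so that ord_max stands
   for the last odd variable x_(2n + 1). *)
Definition mon := (mindex * {set 'I_n.+1})%type.

(* F^o rather than F, so that the vector space structure is inferred. *)
Definition superO := {ffun mon -> F^o}.

(* x^(alpha) x^u, equal to 0 when alpha is not in the index range. *)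
Definition xmon (alpha : 'I_n -> nat) (u : {set 'I_n.+1}) : superO :=
  [ffun b : mon => ([forall i, b.1 i == alpha i :> nat] && (b.2 == u))%:R].

Definition xbas (b : mon) : superO := xmon (fun i => b.1 i) b.2.

Definition parity (b : mon) : bool := odd #|b.2|.

(* The linear map with prescribed values on the basis xbas. *)
Definition ext_fun (V : vectType F) (f : mon -> V) (a : superO) : V :=
  \sum_b (a b : F) *: f b.

Definition ext (V : vectType F) (f : mon -> V) : 'Hom(superO, V) :=
  linfun (ext_fun f).

(* The linear map given by the formula f e a on the homogeneous elements a of
   parity e (see homog_extE below). *)
Definition homog_ext (V : vectType F) (f : bool -> superO -> V) :
    'Hom(superO, V) :=
  ext (fun b => f (parity b) (xbas b)).

Definition homogeneous (e : bool) (a : superO) : Prop :=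
  forall b : mon, a b != 0 -> parity b = e.

(* x^u x^v = osign u v x^(u \cup v) for disjoint u and v: one sign for each
   pair of variables to be swapped. *)
Definition osign (u v : {set 'I_n.+1}) : F :=
  (-1) ^+ #|[set ij : 'I_n.+1 * 'I_n.+1 |
              [&& ij.1 \in u, ij.2 \in v & (ij.2 < ij.1)%N]]|.

(* Left multiplication: mulO a b is the product a b. *)
Definition mulO : 'Hom(superO, 'End(superO)) :=
  ext (fun b => ext (fun c =>
    if [disjoint b.2 & c.2] then
      (osign b.2 c.2 * (\prod_i 'C(b.1 i + c.1 i, b.1 i))%:R) *:
        xmon (fun i => b.1 i + c.1 i)%N (b.2 :|: c.2)
    else 0)).

Definition var_index := ('I_n + 'I_n.+1)%type.

(* The indices 1, ..., 2n, with inl i = i and inr i = i'. *)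
Definition var_index2 := ('I_n + 'I_n)%type.

Definition emb (i : var_index2) : var_index :=
  match i with inl k => inl k | inr k => inr (lift ord_max k) end.

Definition prim (i : var_index2) : var_index2 :=
  match i with inl k => inr k | inr k => inl k end.

Definition mu (r : var_index) : bool := if r is inr _ then true else false.

Definition last_var : var_index := inr ord_max.

Definition unit_index (i : 'I_n) : 'I_n -> nat := fun j => (j == i).

Definition xvar (r : var_index) : superO :=
  match r with
  | inl i => xmon (unit_index i) set0
  | inr j => xmon (fun=> 0%N) [set j]
  end.

(* Odd superderivations act from the left, whence the sign: the variables
   of u preceding x_j have to be crossed. *)
Definition pd (r : var_index) : 'End(superO) :=
  match r with
  | inl i => ext (fun b =>
      if (0 < b.1 i)%N then xmon (fun j => b.1 j - unit_index i j)%N b.2 else 0)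
  | inr j => ext (fun b =>
      if j \in b.2 then
        (-1) ^+ #|[set k in b.2 | (k < j)%N]| *:
          xmon (fun i => b.1 i) (b.2 :\ j)
      else 0)
  end.

Definition eulerD : 'End(superO) :=
  \sum_(i : var_index2) (mulO (xvar (emb i)) \o pd (emb i))%VF.

Definition DeltaI (i : 'I_n) : 'End(superO) :=
  (pd (emb (inl i)) \o pd (emb (prim (inl i))))%VF.

Definition Delta : 'End(superO) := \sum_(i < n) DeltaI i.

Definition T_H (e : bool) (a : superO) : 'End(superO) :=
  \sum_(i : var_index2) (-1) ^+ (mu (emb (prim i)) * e)%N *:
    (mulO (pd (emb (prim i)) a) \o pd (emb i))%VF.

Definition D_KO_formula (e : bool) (a : superO) : 'End(superO) :=
  T_H e a
  + (-1) ^+ e *: (mulO (pd last_var a) \o eulerD)%VF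
  + (mulO (eulerD a - a *+ 2) \o pd last_var)%VF.

Definition D_KO : 'Hom(superO, 'End(superO)) := homog_ext D_KO_formula.

Definition div_formula (e : bool) (a : superO) : superO :=
  ((-1) ^+ e * 2) *:
    (Delta a + (eulerD - (n%:R * lam) *: \1%VF) (pd last_var a)).

Definition div_lam : 'End(superO) := homog_ext div_formula.

Definition par_proj (e : bool) : 'End(superO) :=
  ext (fun b => if parity b == e then xbas b else 0).

(* The component of parity e of an endomorphism. *)
Definition par_comp (e : bool) (D : 'End(superO)) : 'End(superO) :=
  \sum_(d : bool) (par_proj (e (+) d) \o (D \o par_proj d))%VF.

Definition sbracket (D E : 'End(superO)) : 'End(superO) :=
  \sum_(d : bool) \sum_(e : bool)
    ((par_comp d D \o par_comp e E)%VF
     - (-1) ^+ (d * e)%N *: (par_comp e E \o par_comp d D)%VF).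

(* [U, V], the span of all brackets (see bracketP below). *)
Definition bracketv (U V : {vspace 'End(superO)}) : {vspace 'End(superO)} :=
  <<[seq sbracket D E | D <- vbasis U, E <- vbasis V]>>%VS.

Definition SKO2 : {vspace 'End(superO)} := (D_KO @: lker div_lam)%VS.

(* Index pairs (alpha, u) with u not involving x_(2n + 1); i in u stands for
   the variable x_(i'). *)
Definition mon2 := (mindex * {set 'I_n})%type.

Definition xmon2 (alpha : 'I_n -> nat) (u : {set 'I_n}) : superO :=
  xmon alpha [set lift ord_max i | i in u].

Definition zd (alpha : 'I_n -> nat) (u : {set 'I_n}) : nat :=
  (\sum_i alpha i + #|u|)%N.

Definition nabla (i : 'I_n) : 'End(superO) :=
  ext (fun b =>
    mulO (mulO (xmon (fun j => b.1 j + unit_index i j)%N set0)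
               (xvar (emb (prim (inl i)))))
         (xmon (fun=> 0%N) b.2)).

Definition Gam (i j : 'I_n) : 'End(superO) := (nabla j \o DeltaI i)%VF.

Definition Iset (alpha : 'I_n -> nat) (u : {set 'I_n}) : {set 'I_n} :=
  [set i | DeltaI i (xmon2 alpha u) != 0].

Definition Itilde (alpha : 'I_n -> nat) (u : {set 'I_n}) : {set 'I_n} :=
  [set i | nabla i (xmon2 alpha u) != 0].

Definition S5 : seq 'End(superO) :=
  [seq D_KO (mulO (xmon2 (fun i => au.1 i) au.2) (xvar last_var)) |
    au : mon2 <- enum {: mon2} &
    [&& Iset (fun i => au.1 i) au.2 == set0,
        Itilde (fun i => au.1 i) au.2 == set0 &
        n%:R * lam - (zd (fun i => au.1 i) au.2)%:R == 0]].

Definition frakS (l : int) : seq nat :=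
  [seq k <- iota 0 n.+1 | n%:R * lam - n%:R + (2 * k)%:R + l%:~R == 0].

(* Increasing r-tuples of indices, as r-element sets. *)
Definition J (r : nat) : seq {set 'I_n} := enum [set A : {set 'I_n} | #|A| == r].

Definition top_index : 'I_n -> nat := fun i => (p ^ t i - 1)%N.

Definition Xmon (A : {set 'I_n}) : superO :=
  xmon2 (fun i => if i \in A then top_index i else 0%N) (~: A).

Definition Xfamily : seq 'End(superO) :=
  [seq D_KO (Xmon A) | r <- frakS 2, A <- J r].

Definition Gelt (i1 : 'I_n) : 'End(superO) :=
  let alpha := fun i => (top_index i - unit_index i1 i)%N in
  let u := ~: [set i1] in
  let A := xmon2 alpha u - \sum_(i in Iset alpha u) Gam i i1 (xmon2 alpha u) in
  let B := ((-1) ^+ #|u| * (n%:R * lam - (zd alpha u)%:R)) *: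
             nabla i1 (xmon2 alpha u) in
  D_KO (mulO A (xvar last_var) + B).

Fact ext_fun_linear (V : vectType F) (f : mon -> V) : linear (ext_fun f).
Proof.
move=> k a b; rewrite /ext_fun scaler_sumr -big_split /=.
by apply: eq_bigr => c _; rewrite !ffunE scalerDl scalerA.
Qed.
HB.instance Definition _ (V : vectType F) (f : mon -> V) :=
  GRing.isLinear.Build F superO V *:%R (ext_fun f) (ext_fun_linear f).

Lemma extE (V : vectType F) (f : mon -> V) a : ext f a = \sum_b (a b : F) *: f b.
Proof. by rewrite lfunE. Qed.

Lemma xbasE b c : xbas b c = (c == b)%:R.
Proof.
rewrite ffunE; congr (nat_of_bool _)%:R.
apply/andP/eqP => [[/forallP h /eqP h2]|->]; last by split=> //; apply/forallP.
case: c b h h2 => [al u] [be v] /= h ->.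
suff -> : al = be by [].
by apply/ffunP => i; apply: val_inj; apply/eqP/h.
Qed.

Lemma ext_xbas (V : vectType F) (f : mon -> V) b : ext f (xbas b) = f b.
Proof.
rewrite extE (bigD1 b) //= xbasE eqxx scale1r big1 ?addr0 // => c ncb.
by rewrite xbasE (negPf ncb) scale0r.
Qed.

Lemma superO_basis (a : superO) : a = \sum_b (a b : F) *: xbas b.
Proof.
apply/ffunP=> c; rewrite sum_ffunE (bigD1 c) //= ffunE xbasE eqxx.
rewrite big1 => [|b nbc]; first by rewrite addr0 /GRing.scale /= mulr1.
by rewrite ffunE xbasE eq_sym (negPf nbc) /GRing.scale /= mulr0.
Qed.

Lemma homog_extE (V : vectType F) (f : bool -> superO -> V) e a :
  linear (f e) -> homogeneous e a -> homog_ext f a = f e a.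
Proof.
move=> flin ha.
pose fl : {linear superO -> V} := HB.pack (f e) (GRing.isLinear.Build _ _ _ _ (f e) flin).
rewrite extE {2}[a]superO_basis -[f e]/(fl : _ -> _) linear_sum.
apply: eq_bigr => b _; rewrite linearZ /=.
by have [-> |/ha <-//] := eqVneq (a b) 0; rewrite !scale0r.
Qed.

Fact mulO_comp_linear c (h : 'End(superO)) k x y :
  c *: (mulO (k *: x + y) \o h)%VF =
    k *: (c *: (mulO x \o h)%VF) + c *: (mulO y \o h)%VF.
Proof.
by rewrite linearP comp_lfunDl -comp_lfunZl scalerDr !scalerA mulrC.
Qed.

Fact D_KO_formula_linear e : linear (D_KO_formula e).
Proof.
move=> k a b; rewrite /D_KO_formula /T_H.
have -> : eulerD (k *: a + b) - (k *: a + b) *+ 2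
  = k *: (eulerD a - a *+ 2) + (eulerD b - b *+ 2).
  by rewrite linearP mulrnDl opprD scalerBr scalerMnr addrACA.
rewrite -[X in _ + X = _]scale1r [pd last_var _]linearP !mulO_comp_linear !scale1r.
rewrite !scalerDr [RHS]addrACA; congr (_ + _).
rewrite [RHS]addrACA; congr (_ + _).
rewrite scaler_sumr -big_split /=; apply: eq_bigr => i _.
by rewrite linearP mulO_comp_linear.
Qed.

Lemma D_KOE e a : homogeneous e a -> D_KO a = D_KO_formula e a.
Proof. by apply: homog_extE; apply: D_KO_formula_linear. Qed.

Lemma div_lamE e a : homogeneous e a -> div_lam a = div_formula e a.
Proof.
apply: homog_extE => k x y; rewrite /div_formula [pd _ _]linearP.
set E := eulerD - _; set c := _ * 2; rewrite [E _]linearP [Delta _]linearP.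
by rewrite addrACA -[in LHS]scalerDr [LHS]scalerDr !scalerA mulrC.
Qed.

Lemma par_compP e : linear (par_comp e).
Proof.
move=> k D E; rewrite /par_comp scaler_sumr -big_split; apply: eq_bigr => d _ /=.
by rewrite comp_lfunDl -comp_lfunZl comp_lfunDr -comp_lfunZr.
Qed.

Lemma sbracketPl E : linear (sbracket^~ E).
Proof.
move=> k D D'; rewrite /sbracket scaler_sumr -big_split; apply: eq_bigr => d _.
rewrite scaler_sumr -big_split; apply: eq_bigr => e _ /=.
rewrite par_compP comp_lfunDl -comp_lfunZl comp_lfunDr -comp_lfunZr.
by rewrite scalerDr opprD scalerBr !scalerA [_ * k]mulrC addrACA.
Qed.

Lemma sbracketPr D : linear (sbracket D).
Proof.
move=> k E E'; rewrite /sbracket scaler_sumr -big_split; apply: eq_bigr => d _.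
rewrite scaler_sumr -big_split; apply: eq_bigr => e _ /=.
rewrite par_compP comp_lfunDl -comp_lfunZl comp_lfunDr -comp_lfunZr.
by rewrite scalerDr opprD scalerBr !scalerA [_ * k]mulrC addrACA.
Qed.

Lemma bracketP (U V W : {vspace 'End(superO)}) :
  (forall D E, D \in U -> E \in V -> sbracket D E \in W) <->
  (bracketv U V <= W)%VS.
Proof.
split=> [h | h D E DU EV].
  by apply/span_subvP => _ /allpairsP[[D E] /= [DU EV ->]]; rewrite h ?vbasis_mem.
pose bl : {linear 'End(superO) -> 'End(superO)} :=
  HB.pack (sbracket^~ E) (GRing.isLinear.Build _ _ _ _ (sbracket^~ E) (sbracketPl E)).
rewrite (coord_vbasis DU) -[sbracket _ E]/(bl _) linear_sum memv_suml // => i _.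
rewrite linearZ memvZ //=.
pose br : {linear 'End(superO) -> 'End(superO)} :=
  HB.pack (sbracket (vbasis U)`_i)
    (GRing.isLinear.Build _ _ _ _ (sbracket (vbasis U)`_i) (sbracketPr _)).
rewrite (coord_vbasis EV) -[sbracket _ _]/(br _) linear_sum memv_suml // => j _.
rewrite linearZ memvZ //=; apply/(subvP h)/memv_span.
by apply: allpairs_f; apply: mem_nth; rewrite size_tuple.
Qed.

End OddContact.

(* Main.v *)
(* Write c for n lam and cdiv k for Delta + (eul - k) pd_z, where z = x_(2n+1).
   Up to sign, div_lam is 2 cdiv c, so that SKO'' is the image of the kernel of
   cdiv c.  This operator is of second order: if cdiv c kills a and b, then the
   contact bracket of a and b is, up to sign, cdiv (c + 2) (a b).  Hence the
   derived algebra is spanned by the fields of the functions cdiv (c + 2) (a b),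
   and moreover cdiv c \o cdiv (c + 2) = 0.

   The operators nabla_i are homotopies which show, one index i at a time, that
   the homology of Delta is spanned by the monomials X.  It follows that every
   a killed by cdiv c is a combination of some z X (those of S_5), of some
   cdiv (c + 2) (z b), of Delta-exact functions and of monomials X.  Products with
   1, with x_r, and with z + c x_1 x_1' realize all of these in the derived
   algebra, except for the monomials of S_5, the X of weight c + 2, and possibly
   cdiv (c + 2) (z T), where T is the product of all the x^(pi) and x_i'; the
   latter, which is G up to a factor, is 1 / (2 (c + 1)) times a bracket, and also
   comes from the product of z X and of the complementary X if z X is in S_5.

   Conversely, the coefficients of cdiv (c + 2) h at the monomials of S_5 and at
   the X of weight c + 2 are zero by inspection.  Its coefficient at the leading
   monomial of G is the integral of h (its coefficient at z T).  For h = a b this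
   integral vanishes when c = -1 and S_5 is empty, because cdiv c is then the
   adjoint of cdiv (c + 2), of which a and b are images modulo functions free
   of z. *)

Require Import Defs.
From HB Require Import structures.
From mathcomp Require Import all_boot all_order all_algebra.
From mathcomp Require Import ring zify.

Set Implicit Arguments.
Unset Strict Implicit.
Unset Printing Implicit Defensive.

Import GRing.Theory.
Local Open Scope ring_scope.

Local Arguments pd : simpl never.
Local Arguments xvar : simpl never.

(** * Signs of products of odd variables *)

Section SignedSets.

Variables (F : fieldType) (n : nat).
Implicit Types (u v w : {set 'I_n.+1}) (j : 'I_n.+1).

Local Notation osign := (osign F).

Lemma osign_prod u v :
  osign u v = \prod_(i in u) \prod_(j in v) (if (j < i)%N then -1 else 1).
Proof.
rewrite /osign -prodr_const pair_big /=.
rewrite [RHS](bigID (fun ij : 'I_n.+1 * 'I_n.+1 => (ij.2 < ij.1)%N)) /=.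
rewrite [X in _ * X]big1 => [|ij /andP[_ /negPf ->]//]; rewrite mulr1.
apply: eq_big => [ij | ij]; first by rewrite inE andbA.
by rewrite inE => /and3P[_ _ ->].
Qed.

Lemma prod_setU (f : 'I_n.+1 -> F) u v : [disjoint u & v] ->
  \prod_(i in u :|: v) f i = \prod_(i in u) f i * \prod_(i in v) f i.
Proof. by move=> d; rewrite -bigU //; apply: eq_bigl => i; rewrite !inE. Qed.

Lemma disjoint_setU u v w :
  [disjoint u :|: v & w] = [disjoint u & w] && [disjoint v & w].
Proof. by rewrite -!setI_eq0 setIUl setU_eq0. Qed.

Lemma osign0l v : osign set0 v = 1.
Proof. by rewrite osign_prod big_set0. Qed.

Lemma osign0r u : osign u set0 = 1.
Proof. by rewrite osign_prod big1 // => i _; rewrite big_set0. Qed.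

Lemma osignUl u v w : [disjoint u & v] -> osign (u :|: v) w = osign u w * osign v w.
Proof. by move=> d; rewrite !osign_prod prod_setU. Qed.

Lemma osignUr u v w : [disjoint v & w] -> osign u (v :|: w) = osign u v * osign u w.
Proof.
move=> d; rewrite !osign_prod -big_split; apply: eq_bigr => i _.
by rewrite prod_setU.
Qed.

(** A pair with one element in [u] and one in [v] is an inversion for exactly one of the two orders,
    so the two signs multiply to (-1) to the power |u||v|. *)
Lemma osign_swap u v : [disjoint u & v] ->
  osign v u = (-1) ^+ (odd #|u| && odd #|v|) * osign u v.
Proof.
move=> d; rewrite -oddM signr_odd mulnC exprM -!prodr_const !osign_prod.
rewrite exchange_big -big_split; apply: eq_bigr => i iu.
rewrite -big_split; apply: eq_bigr => j jv /=.
case: ltngtP => [||/val_inj ij]; rewrite ?mulN1r ?opprK ?mulr1 //.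
by move/disjointFr: d => /(_ i iu); rewrite ij jv.
Qed.

Lemma osignK u v : osign u v * osign u v = 1.
Proof. by rewrite /osign -exprD addnn -mul2n exprM sqrrN expr1n expr1n. Qed.

Lemma osign_neq0 u v : osign u v != 0.
Proof.
by apply/eqP => o0; have /eqP := osignK u v; rewrite o0 mul0r eq_sym oner_eq0.
Qed.

Lemma osign1E j u : osign [set j] u = (-1) ^+ #|[set k in u | (k < j)%N]|.
Proof.
rewrite osign_prod big_set1 -prodr_const [LHS](bigID (fun k : 'I_n.+1 => (k < j)%N)) /=.
rewrite [X in _ * X]big1 => [|k /andP[_ /negPf ->]//]; rewrite mulr1.
by apply: eq_big => [k | k /andP[_ ->]//]; rewrite inE.
Qed.

Lemma osign11 j : osign [set j] [set j] = 1.
Proof. by rewrite osign_prod !big_set1 ltnn. Qed.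

(* The coefficient of x^(u :|: v) in x^u x^v. *)
Definition osgn u v : F := if [disjoint u & v] then osign u v else 0.

Lemma osgn0l v : osgn set0 v = 1.
Proof. by rewrite /osgn osign0l -setI_eq0 set0I eqxx. Qed.

Lemma osgn0r u : osgn u set0 = 1.
Proof. by rewrite /osgn osign0r -setI_eq0 setI0 eqxx. Qed.

(** Both sides vanish unless the three sets are pairwise disjoint, and are then the product of the
    three pairwise signs. This is the sign part of associativity. *)
Lemma osgn_assoc u v w : osgn u v * osgn (u :|: v) w = osgn v w * osgn u (v :|: w).
Proof.
rewrite /osgn disjoint_setU [[disjoint u & v :|: w]]disjoint_sym disjoint_setU.
rewrite [[disjoint w & _]]disjoint_sym [[disjoint v & u]]disjoint_sym.
have [uv|_] /= := boolP [disjoint u & v]; last by rewrite mul0r mulr0.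
have [vw|_] := boolP [disjoint v & w]; last by rewrite andbF mulr0 mul0r.
have [uw|_] /= := boolP [disjoint u & w]; last by rewrite !mulr0.
by rewrite osignUl // osignUr //; ring.
Qed.

End SignedSets.

(** * The superalgebra of functions: products and parity *)

Section SuperAlgebra.

Variables (F : fieldType) (p n : nat) (t : 'I_n -> nat).

Local Notation O := (superO F p t).
Local Notation "a ** b" := (mulO F p t a b) (at level 40, left associativity).
Local Notation xm := (xmon F p t).
Local Notation pd := (pd F p t).
Local Notation xvar := (xvar F p t).

Implicit Types (a b c : O) (al be ga : 'I_n -> nat) (u v w : {set 'I_n.+1}).
Implicit Types (r s : var_index n) (B C : mon p t) (k : F).

(** Properties stable under linear combinations need only be checked on monomials; most identities
    below are reduced in this way. *)
Lemma superO_ind (Q : O -> Prop) :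
    Q 0 -> (forall k a b, Q a -> Q b -> Q (k *: a + b)) ->
    (forall B, Q (xbas F B)) -> forall a, Q a.
Proof.
move=> Q0 QD Qx a; rewrite [a]superO_basis.
by elim/big_rec: _ => // B b _ Qb; apply: QD.
Qed.

Lemma lfun_xbasP (V : vectType F) (f g : 'Hom(O, V)) :
  (forall B, f (xbas F B) = g (xbas F B)) -> f = g.
Proof.
move=> fg; apply/lfunP => a; elim/superO_ind: a => [|k a b fa fb|//].
  by rewrite !linear0.
by rewrite !linearP /= fa fb.
Qed.

Lemma endZ (f : 'End(O)) k a : f (k *: a) = k *: f a.
Proof. exact: linearZ. Qed.
Lemma endD (f : 'End(O)) a b : f (a + b) = f a + f b.
Proof. exact: linearD. Qed.
Lemma endB (f : 'End(O)) a b : f (a - b) = f a - f b.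
Proof. exact: linearB. Qed.
Lemma endN (f : 'End(O)) a : f (- a) = - f a.
Proof. exact: linearN. Qed.
Lemma end0 (f : 'End(O)) : f 0 = 0.
Proof. exact: linear0. Qed.

Lemma xmon_congr al be u v : al =1 be -> u = v -> xm al u = xm be v.
Proof.
move=> e ->; apply/ffunP => B; rewrite !ffunE.
by congr (nat_of_bool (_ && _))%:R; apply: eq_forallb => i; rewrite e.
Qed.

Lemma xmon_out al u i : (p ^ t i <= al i)%N -> xm al u = 0.
Proof.
move=> h; apply/ffunP => B; rewrite !ffunE (_ : [forall i, _] = false) //.
by apply/forallP => /(_ i) /eqP e; move: h; rewrite -e leqNgt ltn_ord.
Qed.

Lemma xmon_in al u : (forall i, al i < p ^ t i)%N ->
  exists2 B : mon p t, (forall i, B.1 i = al i :> nat) /\ B.2 = u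
                       & xm al u = xbas F B.
Proof.
move=> h; exists ([ffun i => Ordinal (h i)] : mindex p t, u).
  by split=> // i; rewrite ffunE.
by apply: xmon_congr => // i /=; rewrite ffunE.
Qed.

(** Splits a computation into the case of a genuine basis element and the out-of-range case, where
    the monomial is zero. *)
Lemma xmonP al u :
  (exists2 B : mon p t, (forall i, B.1 i = al i :> nat) /\ B.2 = u
                        & xm al u = xbas F B)
  \/ (exists2 i, (p ^ t i <= al i)%N & xm al u = 0).
Proof.
have [h|] := boolP [forall i, al i < p ^ t i]%N.
  by left; apply/xmon_in/forallP.
rewrite negb_forall => /existsP[i]; rewrite -leqNgt => h; right; exists i => //.
exact: xmon_out h.
Qed.

Lemma omulDl a b c : (a + b) ** c = a ** c + b ** c.
Proof. by rewrite linearD add_lfunE. Qed.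
Lemma omulZl k a c : (k *: a) ** c = k *: (a ** c).
Proof. by rewrite linearZ scale_lfunE. Qed.
Lemma omulNl a c : (- a) ** c = - (a ** c).
Proof. by rewrite linearN opp_lfunE. Qed.
Lemma omulBl a b c : (a - b) ** c = a ** c - b ** c.
Proof. by rewrite omulDl omulNl. Qed.
Lemma omul0l c : 0 ** c = 0.
Proof. by rewrite linear0 lfunE. Qed.
Lemma omulDr a b c : a ** (b + c) = a ** b + a ** c.
Proof. exact: linearD. Qed.
Lemma omulZr k a c : a ** (k *: c) = k *: (a ** c).
Proof. exact: linearZ. Qed.
Lemma omulNr a c : a ** (- c) = - (a ** c).
Proof. exact: linearN. Qed.
Lemma omulBr a b c : a ** (b - c) = a ** b - a ** c.
Proof. exact: linearB. Qed.
Lemma omul0r a : a ** 0 = 0.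
Proof. exact: linear0. Qed.

Lemma omul_suml (I : finType) (P : pred I) (f : I -> O) c :
  (\sum_(i | P i) f i) ** c = \sum_(i | P i) f i ** c.
Proof. by rewrite linear_sum sum_lfunE. Qed.
Lemma omul_sumr (I : finType) (P : pred I) (f : I -> O) c :
  c ** (\sum_(i | P i) f i) = \sum_(i | P i) c ** f i.
Proof. exact: linear_sum. Qed.

Definition mulbin al be : F := (\prod_i 'C(al i + be i, al i))%:R.

Lemma mul_xbas B C :
  xbas F B ** xbas F C = (osgn F B.2 C.2 * mulbin (fun i => B.1 i) (fun i => C.1 i))
    *: xm (fun i => B.1 i + C.1 i)%N (B.2 :|: C.2).
Proof.
rewrite /mulO !ext_xbas /osgn; case: ifP => // _.
by rewrite mul0r scale0r.
Qed.

Lemma mul_xmon al be u v :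
  xm al u ** xm be v =
    (osgn F u v * mulbin al be) *: xm (fun i => al i + be i)%N (u :|: v).
Proof.
have [[B [hB hBu ->]]|[i hi ->]] := xmonP al u; last first.
  by rewrite omul0l (@xmon_out _ _ i) ?scaler0 // (leq_trans hi) ?leq_addr.
have [[C [hC hCu ->]]|[i hi ->]] := xmonP be v; last first.
  by rewrite omul0r (@xmon_out _ _ i) ?scaler0 // (leq_trans hi) ?leq_addl.
rewrite mul_xbas hBu hCu; congr (_ * _%:R *: _).
  by apply: eq_bigr => i _; rewrite hB hC.
by apply: xmon_congr => // i; rewrite hB hC.
Qed.

(** Both sides are the product over i of the trinomial coefficients of [al i], [be i] and [ga i]. *)
Lemma mulbin_assoc al be ga :
  mulbin al be * mulbin (fun i => al i + be i)%N ga =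
  mulbin be ga * mulbin al (fun i => be i + ga i)%N.
Proof.
rewrite -!natrM -!big_split; congr _%:R; apply: eq_bigr => i _ /=.
move: (al i) (be i) (ga i) => x y z.
have f m l : ('C(m + l, m) * (m`! * l`!))%N = (m + l)`!.
  by rewrite -{2}[l](addKn m) bin_fact ?leq_addr.
(* Clearing the denominators x! y! z! leaves a consequence of four instances of [f]. *)
apply/eqP; rewrite -(@eqn_pmul2r (x`! * y`! * z`!)) ?muln_gt0 ?fact_gt0 //; apply/eqP.
have := f x y; have := f (x + y)%N z; have := f y z; have := f x (y + z)%N.
by rewrite addnA; nia.
Qed.

Lemma omulA a b c : a ** (b ** c) = a ** b ** c.
Proof.
elim/superO_ind: a => [|k a a' ha ha'|A]; first by rewrite !omul0l.
  by rewrite !omulDl !omulZl ha ha'.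
elim/superO_ind: b => [|k a a' ha ha'|B]; first by rewrite omul0l !omul0r omul0l.
  by rewrite !(omulDl, omulDr, omulZl, omulZr) ha ha'.
elim/superO_ind: c => [|k a a' ha ha'|C]; first by rewrite !omul0r.
  by rewrite !(omulDl, omulDr, omulZl, omulZr) ha ha'.
rewrite !mul_xbas omulZl omulZr !mul_xmon !scalerA.
congr (_ *: _); last by apply: xmon_congr => [i|]; rewrite ?addnA ?setUA.
rewrite mulrACA -osgn_assoc -mulbin_assoc; ring.
Qed.

Definition oneO : O := xm (fun=> 0%N) set0.

Lemma omul1l a : oneO ** a = a.
Proof.
elim/superO_ind: a => [|k a b ha hb|A]; first by rewrite omul0r.
  by rewrite omulDr omulZr ha hb.
rewrite /xbas mul_xmon osgn0l set0U /mulbin big1 ?mulr1 ?scale1r // => i _.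
by rewrite bin0.
Qed.

Lemma omul1r a : a ** oneO = a.
Proof.
elim/superO_ind: a => [|k a b ha hb|A]; first by rewrite omul0l.
  by rewrite omulDl omulZl ha hb.
rewrite /xbas mul_xmon osgn0r setU0 /mulbin big1 ?mulr1 ?scale1r // => [|i _].
  by apply: xmon_congr => // i; rewrite addn0.
by rewrite addn0 binn.
Qed.

(* The power m of the parity automorphism. *)
Definition sg (m : bool) : 'End(O) :=
  ext (fun B => (-1) ^+ (m && parity B) *: xbas F B).

Lemma sg_xbas m B : sg m (xbas F B) = (-1) ^+ (m && parity B) *: xbas F B.
Proof. exact: ext_xbas. Qed.

Lemma sg_xmon m al u : sg m (xm al u) = (-1) ^+ (m && odd #|u|) *: xm al u.
Proof.
have [[B [_ <-] ->]|[i _ ->]] := xmonP al u; first exact: sg_xbas.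
by rewrite linear0 scaler0.
Qed.

Lemma sgE m a B : sg m a B = (-1) ^+ (m && parity B) * a B :> F.
Proof.
elim/superO_ind: a => [|k a b ha hb|C]; first by rewrite linear0 !ffunE mulr0.
  by rewrite linearP /= !ffunE ha hb /GRing.scale /=; ring.
rewrite sg_xbas ffunE xbasE; have [->//|_] := eqVneq B C.
by rewrite mulr0 scaler0.
Qed.

Lemma sg0 a : sg false a = a.
Proof. by apply/ffunP => B; rewrite sgE mul1r. Qed.

Lemma sg_sg m l a : sg m (sg l a) = sg (m (+) l) a.
Proof.
by apply/ffunP => B; rewrite !sgE mulrA -signr_addb -andb_addl.
Qed.

Lemma sgK m a : sg m (sg m a) = a.
Proof. by rewrite sg_sg addbb sg0. Qed.

(** Parity as an eigenvalue equation, so that it passes through operators by rewriting; [pureP]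
    compares it with [homogeneous]. *)
Definition pure (e : bool) a : Prop := sg true a = (-1) ^+ e *: a.

Lemma sg_mul m a b : sg m (a ** b) = sg m a ** sg m b.
Proof.
elim/superO_ind: a => [|k a a' ha ha'|A].
- by rewrite omul0l linear0 omul0l.
- by rewrite omulDl omulZl !(linearP (sg m)) /= ha ha' omulDl omulZl.
elim/superO_ind: b => [|k a a' ha ha'|B].
- by rewrite omul0r linear0 omul0r.
- by rewrite omulDr omulZr !(linearP (sg m)) /= ha ha' omulDr omulZr.
rewrite !sg_xbas omulZl omulZr mul_xbas linearZ /= sg_xmon /osgn.
have [d|_] := boolP [disjoint _ & _]; last by rewrite mul0r !scale0r !scaler0.
have -> : odd #|A.2 :|: B.2| = parity A (+) parity B.
  by rewrite cardsU disjoint_setI0 // cards0 subn0 oddD.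
by rewrite andb_addr signr_addb !scalerA; congr (_ *: _); ring.
Qed.

Lemma superO_coordE :
  ((forall a b B, (a + b)%R B = (a B + b B)%R :> F) *
   (forall a B, (- a)%R B = (- a B)%R :> F) *
   (forall k a B, (k *: a)%R B = (k * a B)%R :> F) *
   (forall B, (0%R : O) B = 0%R :> F))%type.
Proof. by do !split=> *; rewrite !ffunE. Qed.

End SuperAlgebra.

(* Products are kept, so that they can still be expanded and commuted. *)
Ltac generalize_values :=
  repeat match goal with
  | |- context [@fun_of_lfun ?R ?U ?V ?f ?x] =>
      lazymatch f with
      | mulO _ _ _ => fail
      | fun_of_lfun _ _ => fail
      | _ => let y := fresh "y" in move: (@fun_of_lfun R U V f x) => y
      end
  end.

Ltac generalize_products :=
  repeat match goal with
  | |- context [@fun_of_lfun ?R ?U ?V ?f ?x] =>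
      let y := fresh "y" in move: (@fun_of_lfun R U V f x) => y
  end.

(* Decides identities that hold in every module, values of linear maps being
   treated as unknowns. *)
Ltac module_ring :=
  rewrite ?mulr2n; generalize_products;
  apply/ffunP => ?; rewrite !superO_coordE; ring.

Section OddContact.

Variables (F : fieldType) (p n : nat) (t : 'I_n -> nat) (lam : F).
Hypotheses (hp : p \in [pchar F]) (h2 : 2%:R != 0 :> F).
Hypothesis ht : forall i, (0 < t i)%N.

Local Notation O := (superO F p t).
Local Notation "a ** b" := (mulO F p t a b) (at level 40, left associativity).
Local Notation xm := (xmon F p t).
Local Notation pd := (pd F p t).
Local Notation xvar := (xvar F p t).
Local Notation sg := (sg F p t).
Local Notation one := (oneO F p t).
Local Notation hom := (@pure F p n t).

Implicit Types (a b c : O) (al be ga : 'I_n -> nat) (u v w : {set 'I_n.+1}).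
Implicit Types (r s : var_index n) (B C : mon p t) (k : F) (e d m : bool).

(** * Homogeneous elements and partial derivatives *)

Section Derivations.

Lemma pd0 r : pd r 0 = 0. Proof. exact: linear0. Qed.
Lemma pdD r a b : pd r (a + b) = pd r a + pd r b. Proof. exact: linearD. Qed.
Lemma pdN r a : pd r (- a) = - pd r a. Proof. exact: linearN. Qed.
Lemma pdB r a b : pd r (a - b) = pd r a - pd r b. Proof. exact: linearB. Qed.
Lemma pdZ r k a : pd r (k *: a) = k *: pd r a. Proof. exact: linearZ. Qed.

Lemma pureP e a : hom e a <-> homogeneous e a.
Proof.
split=> [h B nz | h]; last first.
  apply/ffunP => B; rewrite sgE ffunE /=.
  by have [->|/h ->//] := eqVneq (a B) 0; rewrite mulr0 scaler0.
move/ffunP/(_ B): h; rewrite sgE ffunE /GRing.scale /= => /(mulIf nz).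
case: (parity B) e => [] [] //= /eqP; rewrite ?expr1 ?expr0 => /eqP h.
  by case/eqP: h2; rewrite mulr2n -{1}h addNr.
by case/eqP: h2; rewrite mulr2n {1}h addNr.
Qed.

Lemma hom_sg e m a : hom e a -> sg m a = (-1) ^+ (m && e) *: a.
Proof. by case: m => // _ /=; rewrite sg0 scale1r. Qed.

Lemma hom0 e : hom e (0 : O).
Proof. by rewrite /pure linear0 scaler0. Qed.

Lemma homD e a b : hom e a -> hom e b -> hom e (a + b).
Proof. by rewrite /pure linearD /= scalerDr => -> ->. Qed.

Lemma homZ e k a : hom e a -> hom e (k *: a).
Proof. by rewrite /pure linearZ /= => ->; rewrite !scalerA mulrC. Qed.

Lemma homN e a : hom e a -> hom e (- a).
Proof. by rewrite /pure linearN /= scalerN => ->. Qed.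

Lemma homB e a b : hom e a -> hom e b -> hom e (a - b).
Proof. by move=> ha /homN; apply: homD. Qed.

Lemma hom_sum (I : finType) (P : pred I) e (f : I -> O) :
  (forall i, P i -> hom e (f i)) -> hom e (\sum_(i | P i) f i).
Proof.
move=> h; elim/big_rec: _ => [|i a Pi ha]; first exact: hom0.
exact/homD/ha/h.
Qed.

Lemma hom_mul e d a b : hom e a -> hom d b -> hom (e (+) d) (a ** b).
Proof.
rewrite /pure sg_mul => -> ->.
by rewrite omulZl omulZr scalerA signr_addb.
Qed.

Lemma hom_xmon al u : hom (odd #|u|) (xm al u).
Proof. exact: sg_xmon. Qed.

Lemma hom_xbas B : hom (parity B) (xbas F B).
Proof. exact: hom_xmon. Qed.

Lemma hom_xvar r : hom (mu r) (xvar r).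
Proof.
case: r => i; first by have := @hom_xmon (unit_index i) set0; rewrite cards0.
by have := @hom_xmon (fun=> 0%N) [set i]; rewrite cards1.
Qed.

Lemma hom_eq e d a : hom e a -> e = d -> hom d a.
Proof. by move=> h <-. Qed.

Lemma xbas_scomm B a : xbas F B ** a = sg (parity B) a ** xbas F B.
Proof.
elim/superO_ind: a => [|k a b ha hb|C]; first by rewrite (linear0 (sg _)) omul0l omul0r.
  by rewrite (linearP (sg _)) /= omulDr omulZr omulDl omulZl ha hb.
rewrite sg_xbas omulZl !mul_xbas /osgn disjoint_sym.
have [d|_] := boolP [disjoint _ & _]; last by rewrite !mul0r !scale0r scaler0.
rewrite scalerA [osign _ B.2 _](@osign_swap _ _ C.2) //.
have -> : mulbin F (fun i => C.1 i) (fun i => B.1 i)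
        = mulbin F (fun i => B.1 i) (fun i => C.1 i).
  rewrite /mulbin; congr _%:R; apply: eq_bigr => i _.
  by rewrite -[in LHS]bin_sub ?leq_addr // addKn addnC.
rewrite andbC !mulrA; congr (_ *: _).
by apply: xmon_congr => [i|]; rewrite ?(addnC (B.1 i)) // setUC.
Qed.

(** Putting the sign into [sg e b] lets [b] be a sum of both parities. *)
Lemma scomm e a b : hom e a -> a ** b = sg e b ** a.
Proof.
move=> ha; rewrite [a]superO_basis omul_suml omul_sumr.
apply: eq_bigr => B _; rewrite omulZl omulZr.
have [->|/((pureP _ _).1 ha) <-] := eqVneq (a B) 0; first by rewrite !scale0r.
by rewrite xbas_scomm.
Qed.

Lemma scomm_hom e d a b : hom e a -> hom d b -> a ** b = (-1) ^+ (e && d) *: (b ** a).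
Proof. by move=> ha hb; rewrite (scomm b ha) (hom_sg _ hb) omulZl. Qed.

(** The bound excludes [al i] equal to p ^ t i, where the left side is the derivative of zero but
    the right side would be a nonzero monomial. *)
Lemma pd_inl_xmon i al u : (al i < p ^ t i)%N ->
  pd (inl i) (xm al u) =
    ((0 < al i)%N)%:R *: xm (fun j => al j - unit_index i j)%N u.
Proof.
have [[B [hB <-] ->] _|[j hj ->] hi] := xmonP F p t al u.
  rewrite ext_xbas -hB; case: ifP => _; rewrite ?scale0r ?scale1r //.
  by apply: xmon_congr => // j; rewrite hB.
rewrite linear0 (@xmon_out _ _ _ _ _ _ j) ?scaler0 // /unit_index.
by case: eqP hj hi => [->|_]; rewrite ?subn0 // => h; rewrite ltnNge h.
Qed.

Lemma pd_inr_xmon j al u :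
  pd (inr j) (xm al u) = ((j \in u)%:R * osign F [set j] u) *: xm al (u :\ j).
Proof.
have [[B [hB <-] ->]|[i hi ->]] := xmonP F p t al u; last first.
  by rewrite linear0 (@xmon_out _ _ _ _ _ _ i) ?scaler0.
rewrite ext_xbas osign1E; case: ifP => _; last by rewrite mul0r scale0r.
by rewrite mul1r; congr (_ *: _); apply: xmon_congr.
Qed.

Lemma bin_pascal x y :
  ((0 < x) * 'C(x.-1 + y, x.-1) + (0 < y) * 'C(x + y.-1, x) =
   (0 < x + y) * 'C(x + y, x))%N.
Proof.
case: x y => [|x] [|y] //; rewrite ?bin0 ?addn0 ?binn //= ?addn0 ?binn //.
by rewrite !mul1n addnS binS addSn addnC addnS.
Qed.

(** From x C(p^q, x) = p^q C(p^q - 1, x - 1): if p did not divide the binomial, p^q would divide x.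
    This is what makes the truncation of the divided powers compatible with derivations. *)
Lemma dvdn_bin_pfactor q x : (0 < x < p ^ q)%N -> (p %| 'C(p ^ q, x))%N.
Proof.
have pp := pcharf_prime hp.
case: x => // x /andP[_ xq]; apply/negPn/negP => ndiv.
have h := mul_bin_diag (p ^ q) x.
have : (p ^ q %| x.+1 * 'C(p ^ q, x.+1))%N by rewrite -h dvdn_mulr.
rewrite Gauss_dvdl ?coprimeXl ?prime_coprime //.
by move/dvdn_leq => /(_ isT); rewrite leqNgt xq.
Qed.

(** On monomials with exponents x and y at i: below the bound p ^ t i for x + y this is Pascal's
    rule, above it all terms vanish, and at the bound the surviving coefficient is divisible by
    p. *)
Lemma pd_inl_mul i a b : pd (inl i) (a ** b) = pd (inl i) a ** b + a ** pd (inl i) b.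
Proof.
elim/superO_ind: a => [|k a a' ha ha'|A].
- by rewrite omul0l !(linear0 (pd _)) !omul0l addr0.
- by rewrite !(omulDl, omulZl, linearP (pd _)) /= ha ha' scalerDr addrACA.
elim/superO_ind: b => [|k a a' ha ha'|B].
- by rewrite omul0r !(linear0 (pd _)) !omul0r addr0.
- rewrite !(omulDr, omulZr) !(linearP (pd _)) /= omulDr omulZr ha ha'.
  by rewrite scalerDr addrACA.
rewrite /xbas !pd_inl_xmon ?ltn_ord // omulZl omulZr !mul_xmon linearZ /=.
set x := nat_of_ord (A.1 i); set y := nat_of_ord (B.1 i).
(* The binomials at the other indices, common to all three products. *)
pose R : F := (\prod_(j | j != i) 'C(A.1 j + B.1 j, A.1 j))%:R.
have E (f g : 'I_n -> nat) :
    (forall j, j != i -> f j = A.1 j :> nat /\ g j = B.1 j :> nat) ->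
    mulbin F f g = 'C(f i + g i, f i)%:R * R.
  move=> h; rewrite /mulbin (bigD1 i) //= natrM; congr (_ * _%:R).
  by apply: eq_bigr => j /h[-> ->].
have E1 j : j != i -> unit_index i j = 0%N by rewrite /unit_index => /negPf ->.
have E2 : unit_index i i = 1%N by rewrite /unit_index eqxx.
rewrite !E //; try by move=> j /E1 ->; rewrite ?subn0.
rewrite /= E2 -/x -/y !subn1.
set M := xm (fun j => A.1 j + B.1 j - unit_index i j)%N (A.2 :|: B.2).
have M1 : (0 < x)%N%:R *:
   xm (fun j => A.1 j - unit_index i j + B.1 j)%N (A.2 :|: B.2) = (0 < x)%N%:R *: M.
  case: posnP => [_|x0]; rewrite ?scale0r // !scale1r; apply: xmon_congr => // j.
  by have [->|/E1 ->] := eqVneq j i; rewrite ?subn0 // E2 addnBAC.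
have M2 : (0 < y)%N%:R *:
   xm (fun j => A.1 j + (B.1 j - unit_index i j))%N (A.2 :|: B.2) = (0 < y)%N%:R *: M.
  case: posnP => [_|y0]; rewrite ?scale0r // !scale1r; apply: xmon_congr => // j.
  by have [->|/E1 ->] := eqVneq j i; rewrite ?subn0 // E2 addnBA.
rewrite !scalerA ![_%:R * (_ * _)]mulrC -!scalerA M1 M2 !scalerA -scalerDl.
have -> : osgn F A.2 B.2 * 'C(x.-1 + y, x.-1)%:R * R * (0 < x)%N%:R
   + osgn F A.2 B.2 * 'C(x + y.-1, x)%:R * R * (0 < y)%N%:R
  = osgn F A.2 B.2 * R * (0 < x + y)%N%:R * 'C(x + y, x)%:R.
  rewrite -[RHS]mulrA -[_%:R * _%:R]natrM -bin_pascal natrD !natrM; ring.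
have [xy|xy] := ltnP (x + y) (p ^ t i).
  by rewrite pd_inl_xmon // scalerA; congr (_ *: _); ring.
rewrite (@xmon_out _ _ _ _ _ _ i) // linear0 scaler0.
move: xy; rewrite leq_eqVlt => /orP[/eqP exy|xy]; last first.
  rewrite /M (@xmon_out _ _ _ _ _ _ i) ?scaler0 // E2 leq_subRL ?add1n //.
  exact: leq_ltn_trans xy.
(* Boundary case: the product is zero, while the right side is a possibly nonzero monomial with
   coefficient C(p ^ t i, x). *)
rewrite -exy (_ : 'C(_, _)%:R = 0) ?mulr0 ?scale0r //; apply/eqP.
rewrite -(dvdn_pcharf hp) dvdn_bin_pfactor // ltn_ord andbT lt0n; apply/eqP => x0.
by move: exy (ltn_ord (B.1 i)); rewrite x0 -/y => ->; rewrite ltnn.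
Qed.

End Derivations.

(** * The Leibniz rule for odd derivatives, and commutation of derivatives *)

Section OddLeibniz.

Implicit Types (i : 'I_n) (j : 'I_n.+1).
Local Notation osign := (osign F).
Local Notation osgn := (osgn F).

Lemma disjoint1 j u : [disjoint [set j] & u] = (j \notin u).
Proof. by rewrite disjoints1. Qed.

Lemma osign_self j u : osign [set j] (j |: u) = osign [set j] u.
Proof.
have [ju|ju] := boolP (j \in u); first by rewrite (setUidPr _) ?sub1set.
by rewrite osignUr ?disjoint1 // osign11 mul1r.
Qed.

Lemma osgnU1l j u v : j \notin u -> j \notin v ->
  osgn (j |: u) v = osign [set j] v * osgn u v.
Proof.
move=> ju jv; rewrite /osgn disjoint_setU disjoint1 jv /=.
by case: ifP => _; rewrite ?mulr0 // osignUl ?disjoint1.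
Qed.

Lemma osgnU1r j u v : j \notin u -> j \notin v ->
  osgn u (j |: v) = (-1) ^+ odd #|u| * osign [set j] u * osgn u v.
Proof.
move=> ju jv; rewrite /osgn disjoint_sym disjoint_setU disjoint1 ju /= disjoint_sym.
case: ifP => _; rewrite ?mulr0 // osignUr ?disjoint1 //.
by rewrite (@osign_swap _ _ [set j]) ?disjoint1 // cards1.
Qed.

Lemma pd_inr_mul j a b :
  pd (inr j) (a ** b) = pd (inr j) a ** b + sg true a ** pd (inr j) b.
Proof.
elim/superO_ind: a => [|k a a' ha ha'|A].
- by rewrite omul0l !(linear0 (pd _)) (linear0 (sg _)) !omul0l addr0.
- by rewrite !(omulDl, omulZl, linearP (pd _), linearP (sg _)) /= ha ha' scalerDr addrACA.
elim/superO_ind: b => [|k a a' ha ha'|B].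
- by rewrite omul0r !(linear0 (pd _)) !omul0r addr0.
- rewrite !(omulDr, omulZr) !(linearP (pd _)) /= omulDr omulZr ha ha'.
  by rewrite scalerDr addrACA.
rewrite sg_xbas /xbas !pd_inr_xmon !omulZl omulZr !mul_xmon linearZ /= pd_inr_xmon.
rewrite !scalerA /parity; case: A B => [al u] [be v] /=.
set bi := mulbin _ _ _; set ga := fun i => (_ + _)%N; rewrite !inE.
have [ju|ju] := boolP (j \in u); have [jv|jv] := boolP (j \in v);
  rewrite ?(mul0r, mulr0, scale0r, add0r, addr0, mul1r) //.
(* Here x_j occurs in both factors: the product is zero and the two terms of the rule cancel. *)
- have [u' ju' ->] : exists2 u' : {set 'I_n.+1}, j \notin u' & u = j |: u'.
    by exists (u :\ j); rewrite ?setD1K // !inE eqxx.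
  have [v' jv' ->] : exists2 v' : {set 'I_n.+1}, j \notin v' & v = j |: v'.
    by exists (v :\ j); rewrite ?setD1K // !inE eqxx.
  rewrite {1}/osgn -setI_eq0 (_ : _ == set0 = false); last first.
    by apply/eqP/setP => /(_ j); rewrite !inE eqxx.
  rewrite !mul0r scale0r !setU1K // !osign_self osgnU1l // osgnU1r // cardsU1 ju' /=.
  rewrite setUCA setUA -scalerDl (_ : _ + _ = 0) ?scale0r //.
  have := osignK F [set j] u'; have := osignK F [set j] v'.
  by move=> K1 K2; case: (odd _) => /=; ring: K1 K2.
- have [u' ju' ->] : exists2 u' : {set 'I_n.+1}, j \notin u' & u = j |: u'.
    by exists (u :\ j); rewrite ?setD1K // !inE eqxx.
  rewrite osgnU1l // -setUA !osign_self !setU1K ?inE ?negb_or ?ju' //.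
  rewrite /osgn; case: ifP => [d|_]; last by rewrite !(mulr0, mul0r, scale0r).
  rewrite osignUr //; congr (_ *: _).
  rewrite -[RHS]mul1r -(osignK F [set j] v); ring.
have [v' jv' ->] : exists2 v' : {set 'I_n.+1}, j \notin v' & v = j |: v'.
  by exists (v :\ j); rewrite ?setD1K // !inE eqxx.
rewrite osgnU1r // setUCA !osign_self !setU1K ?inE ?negb_or ?ju //.
rewrite /osgn; case: ifP => [d|_]; last by rewrite !(mulr0, mul0r, scale0r).
rewrite osignUr //; congr (_ *: _).
rewrite -[RHS]mul1r -(osignK F [set j] u); ring.
Qed.

Lemma pd_mul r a b : pd r (a ** b) = pd r a ** b + sg (mu r) a ** pd r b.
Proof. by case: r => [i|j] /=; [rewrite pd_inl_mul // sg0 | apply: pd_inr_mul]. Qed.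

Lemma pd_comm r s a : pd r (pd s a) = (-1) ^+ (mu r && mu s) *: pd s (pd r a).
Proof.
elim/superO_ind: a => [|k a a' ha ha'|B].
- by rewrite !(linear0 (pd _)) scaler0.
- by rewrite !(linearP (pd _)) /= ha ha' scalerDr !scalerA mulrC.
have lB x i : (B.1 i - x < p ^ t i)%N by rewrite (leq_ltn_trans (leq_subr _ _)).
rewrite /xbas; case: r s => [i|j] [i'|j'] /=; rewrite ?scale1r.
- rewrite !pd_inl_xmon ?ltn_ord // !pdZ !pd_inl_xmon ?lB // !scalerA.
  have [-> //|ii'] := eqVneq i i'.
  rewrite /unit_index (negPf ii') eq_sym (negPf ii') !subn0 mulrC.
  by congr (_ *: _); apply: xmon_congr => // l; rewrite subnAC.
- rewrite pd_inr_xmon pd_inl_xmon ?ltn_ord // !pdZ.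
  by rewrite pd_inr_xmon pd_inl_xmon ?ltn_ord // !scalerA mulrC.
- rewrite pd_inr_xmon pd_inl_xmon ?ltn_ord // !pdZ.
  by rewrite pd_inr_xmon pd_inl_xmon ?ltn_ord // !scalerA mulrC.
rewrite !pd_inr_xmon !pdZ !pd_inr_xmon !scalerA !inE.
have [->|jj] := eqVneq j j'; first by rewrite /= !(mul0r, mulr0) !scale0r ?scaler0.
have [ju|ju] := boolP (j \in B.2); last by rewrite ?andbF !(mul0r, mulr0, scale0r).
have [ju'|ju'] := boolP (j' \in B.2); last by rewrite ?andbF !(mul0r, mulr0, scale0r).
have -> : B.2 :\ j' :\ j = B.2 :\ j :\ j' by apply/setP => l; rewrite !inE andbCA.
rewrite !mul1r expr1; congr (_ *: _).
set w := B.2 :\ j :\ j'.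
have e1 : B.2 :\ j = j' |: w by rewrite setD1K // !inE eq_sym jj.
have e2 : B.2 :\ j' = j |: w.
  by apply/setP => l; rewrite !inE; have [->|//] := eqVneq l j; rewrite ?jj ?ju // andbT.
have e3 : B.2 = j |: (j' |: w) by rewrite -e1 setD1K.
have jw : j \notin w by rewrite !inE eqxx andbF.
have jw' : j' \notin w by rewrite !inE eqxx.
rewrite e1 e2 e3 !osign_self setUCA osign_self !osignUr ?disjoint1 //.
rewrite (@osign_swap _ _ [set j]) ?disjoint1 ?inE // !cards1 /=; ring.
Qed.

End OddLeibniz.

(** * The operators of the odd contact algebra *)

Section ContactOperators.

Implicit Types (i : var_index2 n).
Local Notation z := (last_var n).
Local Notation eul := (eulerD F p t).
Local Notation Delta := (Delta F p t).

Lemma eulE a : eul a = \sum_i xvar (emb i) ** pd (emb i) a.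
Proof. by rewrite sum_lfunE; apply: eq_bigr => i _; rewrite comp_lfunE. Qed.

Lemma DeltaE a :
  Delta a = \sum_(k < n) pd (emb (inl k)) (pd (emb (inr k)) a).
Proof. by rewrite sum_lfunE; apply: eq_bigr => k _; rewrite comp_lfunE. Qed.

Lemma T_HE e a b : T_H e a b = \sum_i (-1) ^+ (mu (emb (prim i)) && e) *:
  (pd (emb (prim i)) a ** pd (emb i) b).
Proof.
rewrite /T_H sum_lfunE; apply: eq_bigr => i _.
by rewrite scale_lfunE comp_lfunE mulnb.
Qed.

(* Half of div_lam, up to sign, with c in place of n lambda. *)
Definition cdiv (c : F) : 'End(O) := (Delta + ((eul - c *: \1) \o pd z))%VF.

Lemma cdivE k a : cdiv k a = Delta a + (eul (pd z a) - k *: pd z a).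
Proof. by rewrite /cdiv !(add_lfunE, comp_lfunE, opp_lfunE, scale_lfunE, id_lfunE). Qed.

Local Opaque mulO Defs.pd eulerD Defs.Delta T_H cdiv fun_of_lfun.

Lemma pexpn_gt1 (i : 'I_n) : (1 < p ^ t i)%N.
Proof. by rewrite -[1%N](exp1n (t i)) ltn_exp2r ?ht // prime_gt1 ?(pcharf_prime hp). Qed.

Lemma sg_pd m r a : sg m (pd r a) = (-1) ^+ (m && mu r) *: pd r (sg m a).
Proof.
elim/superO_ind: a => [|k a b ha hb|B].
- by rewrite pd0 !(linear0 (sg _)) pd0 scaler0.
- rewrite pdD pdZ !(linearP (sg _)) /= ha hb pdD pdZ scalerDr !scalerA.
  by rewrite mulrC.
rewrite sg_xbas pdZ scalerA /xbas; case: r => [i|j].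
  rewrite pd_inl_xmon ?ltn_ord // linearZ /= sg_xmon !scalerA andbF mul1r.
  by rewrite mulrC.
rewrite pd_inr_xmon linearZ /= sg_xmon !scalerA /parity.
have [jB|_] := boolP (j \in B.2); last by rewrite !(mul0r, mulr0) !scale0r.
rewrite (cardsD1 j B.2) jB add1n oddS andbT; congr (_ *: _).
by case: m; case: (odd _) => /=; ring.
Qed.

Lemma hom_pd r e a : hom e a -> hom (mu r (+) e) (pd r a).
Proof.
by rewrite /pure sg_pd => ->; rewrite pdZ scalerA signr_addb.
Qed.

Lemma pd_one r : pd r one = 0.
Proof.
case: r => i; rewrite /oneO; last by rewrite pd_inr_xmon inE mul0r scale0r.
by rewrite pd_inl_xmon ?(ltnW (pexpn_gt1 i)) //; apply: scale0r.
Qed.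

Lemma pd_xvar r s : pd r (xvar s) = (r == s)%:R *: one.
Proof.
case: r s => [i|j] [i'|j'] /=.
- rewrite pd_inl_xmon; last first.
    by rewrite /unit_index; case: eqP => _; [apply: pexpn_gt1 | apply/ltnW/pexpn_gt1].
  rewrite /unit_index -[inl i == _]/(i == i'); case: eqP => [->|_]; rewrite ?scale0r //.
  by congr (_ *: _); apply: xmon_congr => // l; rewrite subnn.
- by rewrite pd_inl_xmon ?(ltnW (pexpn_gt1 i)) // [RHS]scale0r; apply: scale0r.
- by rewrite pd_inr_xmon inE mul0r !scale0r.
rewrite pd_inr_xmon inE -[inr j == _]/(j == j'); case: eqP => [->|_].
  by rewrite osign11 mul1r setDv.
by rewrite mul0r !scale0r.
Qed.

Lemma emb_inj : injective (@emb n).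
Proof.
case=> i [j|j] //= e; first by case: e => ->.
have := congr1 (fun r : var_index n => if r is inr l then l else ord_max) e.
by move/lift_inj => ->.
Qed.

Lemma emb_neq_last i : (emb i == z) = false.
Proof.
case: i => i //; apply/eqP => e.
have := congr1 (fun r : var_index n => if r is inr l then l else ord_max) e.
by move/eqP; rewrite /= eq_sym (negPf (neq_lift _ _)).
Qed.

Lemma var_cases r : (exists i, r = emb i) \/ r = z.
Proof.
case: r => j; first by left; exists (inl j).
by case: (unliftP ord_max j) => [i ->|->]; [left; exists (inr i) | right].
Qed.

Lemma eul_mul a b : eul (a ** b) = eul a ** b + a ** eul b.
Proof.
rewrite !eulE omul_suml omul_sumr -big_split; apply: eq_bigr => i _ /=.
rewrite pd_mul // omulDr !omulA; congr (_ + _).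
by rewrite (scomm _ (hom_xvar _)) sgK.
Qed.

(** [eul] measures the degree in all variables except z, so every derivative except the one by z
    lowers this degree by one. *)
Lemma pd_eul r a : pd r (eul a) = eul (pd r a) + (r != z)%:R *: pd r a.
Proof.
rewrite !eulE linear_sum (eq_bigr (fun i => xvar (emb i) ** pd (emb i) (pd r a)
   + (r == emb i)%:R *: pd r a)) => [|i _]; last first.
  rewrite /= pd_mul // pd_xvar omulZl omul1l addrC (hom_sg _ (hom_xvar _)).
  rewrite pd_comm omulZl omulZr scalerA -signr_addb andbC addbb scale1r.
  by congr (_ + _); case: eqP => [->|]; rewrite ?scale0r.
rewrite big_split; congr (_ + _); rewrite -scaler_suml; congr (_ *: _).
have [[i ->]|->] := var_cases r.
  rewrite (bigD1 i) //= eqxx emb_neq_last big1 ?addr0 // => j ji.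
  by rewrite (inj_eq emb_inj) eq_sym (negPf ji).
by rewrite eqxx big1 // => i _; rewrite eq_sym emb_neq_last.
Qed.

Lemma pd_eul_emb i a : pd (emb i) (eul a) = eul (pd (emb i) a) + pd (emb i) a.
Proof. by rewrite pd_eul emb_neq_last scale1r. Qed.

Lemma pd_eul_last a : pd z (eul a) = eul (pd z a).
Proof. by rewrite pd_eul eqxx scale0r addr0. Qed.

Lemma sg_eul m a : sg m (eul a) = eul (sg m a).
Proof.
rewrite !eulE linear_sum; apply: eq_bigr => i _ /=.
rewrite sg_mul (hom_sg _ (hom_xvar _)) sg_pd omulZl omulZr scalerA.
by rewrite -signr_addb addbb scale1r.
Qed.

Lemma hom_eul e a : hom e a -> hom e (eul a).
Proof. by rewrite /pure sg_eul => ->; rewrite linearZ. Qed.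

Lemma eul_xvar i : eul (xvar (emb i)) = xvar (emb i).
Proof.
rewrite eulE (bigD1 i) //= pd_xvar eqxx scale1r omul1r big1 ?addr0 // => j ji.
by rewrite pd_xvar (inj_eq emb_inj) (negPf ji) scale0r omul0r.
Qed.

Lemma eul_last : eul (xvar z) = 0.
Proof.
by rewrite eulE big1 // => i _; rewrite pd_xvar emb_neq_last scale0r omul0r.
Qed.

Lemma Delta_pd r a : Delta (pd r a) = (-1) ^+ mu r *: pd r (Delta a).
Proof.
rewrite !DeltaE linear_sum scaler_sumr; apply: eq_bigr => k _ /=.
by rewrite (pd_comm (inr _) r) pdZ pd_comm /= scale1r.
Qed.

Lemma Delta_sg m a : Delta (sg m a) = (-1) ^+ m *: sg m (Delta a).
Proof.
rewrite !DeltaE linear_sum scaler_sumr; apply: eq_bigr => k _ /=.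
by rewrite !sg_pd pdZ !scalerA !andbF andbT mulr1 -expr2 sqrr_sign scale1r.
Qed.

Lemma eq_opp0 a : a = - a -> a = 0.
Proof.
move=> h; have : 2%:R *: a = 0 by rewrite scaler_nat mulr2n {1}h addNr.
by move/eqP; rewrite scaler_eq0 (negPf h2) => /eqP.
Qed.

(** The second-order operators [dd k] anticommute, also with themselves, so the double sum equals
    its own opposite. *)
Lemma Delta_Delta a : Delta (Delta a) = 0.
Proof.
pose dd (k : 'I_n) a := pd (emb (inl k)) (pd (emb (inr k)) a) : O.
have ddC (k l : 'I_n) b : dd k (dd l b) = - dd l (dd k b).
  rewrite /dd (pd_comm (emb (inr k)) (emb (inl l))) pdZ.
  rewrite (pd_comm (emb (inr k)) (emb (inr l))) !pdZ.
  rewrite (pd_comm (emb (inl k)) (emb (inl l))) (pd_comm (emb (inl k)) (emb (inr l))).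
  by rewrite pdZ /= !(expr0, expr1, scale1r, scaleN1r).
have DD : Delta (Delta a) = \sum_k \sum_l dd k (dd l a).
  rewrite DeltaE; apply: eq_bigr => k _.
  by rewrite -!(linear_sum (pd _)) -DeltaE.
apply: eq_opp0; rewrite {1}DD exchange_big DD -sumrN; apply: eq_bigr => k _.
by rewrite -sumrN; apply: eq_bigr => l _; apply: ddC.
Qed.

Lemma Delta_eul a : Delta (eul a) = eul (Delta a) + Delta a *+ 2.
Proof.
rewrite !DeltaE linear_sum -sumrMnl -big_split; apply: eq_bigr => k _ /=.
rewrite (pd_eul_emb (inr k)) pdD (pd_eul_emb (inl k)) mulr2n addrA.
by [].
Qed.

Lemma pd_pd_last a : pd z (pd z a) = 0.
Proof. by apply: eq_opp0; rewrite {1}pd_comm expr1 scaleN1r. Qed.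

Lemma pd_cdiv k a : pd z (cdiv k a) = - Delta (pd z a).
Proof.
rewrite cdivE pdD pdB pdZ pd_eul_last pd_pd_last scaler0 linear0 subr0 addr0.
by rewrite Delta_pd expr1 scaleN1r opprK.
Qed.

(** The shift by 2 cancels the commutator of [Delta] and [eul], which is 2 [Delta]. *)
Lemma cdiv_cdiv k a : cdiv k (cdiv (k + 2%:R) a) = 0.
Proof.
rewrite cdivE pd_cdiv cdivE linearD linearB linearZ linearN /= Delta_Delta Delta_eul.
module_ring.
Qed.

Lemma cdiv_sg k m a : cdiv k (sg m a) = (-1) ^+ m *: sg m (cdiv k a).
Proof.
have E : pd z (sg m a) = (-1) ^+ m *: sg m (pd z a).
  by rewrite sg_pd andbT scalerA -expr2 sqrr_sign scale1r.
rewrite !cdivE E Delta_sg (endZ eul) -sg_eul.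
rewrite (linearD (sg m)) (linearB (sg m)) /= endZ scalerDr scalerBr.
by rewrite !scalerA mulrC.
Qed.

Lemma div_lam_cdiv a : div_lam p t lam a = 2%:R *: cdiv (n%:R * lam) (sg true a).
Proof.
elim/superO_ind: a => [|k a b ha hb|B].
- by rewrite !linear0.
- rewrite (linearP (div_lam _ _ _)) (linearP (sg _)) (linearP (cdiv _)) /= ha hb.
  by rewrite scalerDr !scalerA mulrC.
rewrite ext_xbas sg_xbas linearZ /= scalerA mulrC /div_formula; congr (_ *: _).
by rewrite cdivE !(add_lfunE, opp_lfunE, scale_lfunE, id_lfunE).
Qed.

(** [Delta] is of second order; its failure to be a derivation is the odd Poisson (Buttin) bracket
    [T_H]. *)
Lemma Delta_mul e a b : hom e a -> Delta (a ** b) =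
  Delta a ** b + (-1) ^+ e *: (a ** Delta b) + (-1) ^+ e *: T_H e a b.
Proof.
move=> ha; rewrite !DeltaE T_HE big_sumType /= omul_suml omul_sumr.
rewrite scalerDr !scaler_sumr addrA -!big_split; apply: eq_bigr => k _ /=.
rewrite !pd_mul // pdD !pd_mul //= !sg0 (hom_sg _ ha) pdZ !omulZl.
by case: e ha => _ /=; module_ring.
Qed.

(** The contact bracket: the field of [a] applied to [b], corrected by a multiple of [b]. It
    generates the commutator of the two fields, see [sbracket_DKO]. *)
Definition brk e a b : O :=
  T_H e a b + (-1) ^+ e *: (pd z a ** eul b) + (eul a - a *+ 2) ** pd z b
  - ((-1) ^+ e *+ 2) *: (pd z a ** b).

(** [Delta] contributes [T_H], and the part with [pd z] the cross terms. Passing from k to k + 2 on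
    the product produces the two terms of [brk] with the factor 2. *)
Lemma cdiv_mul k e a b : hom e a -> cdiv (k + 2%:R) (a ** b) =
  cdiv k a ** b + (-1) ^+ e *: (a ** cdiv k b) + (-1) ^+ e *: brk e a b.
Proof.
have Ea := cdivE k a; have Eb := cdivE k b.
move=> ha; rewrite [LHS]cdivE Ea Eb (Delta_mul _ ha) pd_mul //.
rewrite (hom_sg _ ha) omulZl.
rewrite /brk (endD eul) (endZ eul) !eul_mul.
rewrite !(omulDl, omulDr, omulBl, omulBr, omulZl, omulZr, omulNl, omulNr).
by case: e ha => _ /=; module_ring.
Qed.

End ContactOperators.

Local Notation z := (last_var n).
Local Notation eul := (eulerD F p t).
Local Notation Delta := (Delta F p t).
Local Notation dko := (@D_KO_formula F p n t).
Local Notation DKO := (D_KO F p t).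

(* Keeps unification from unfolding these operators when a rewrite fails. *)
Local Opaque mulO Defs.pd eulerD Defs.Delta T_H cdiv fun_of_lfun.

(** * The contact bracket *)

Section ContactBracket.

Implicit Types (i : var_index2 n) (D E : 'End(O)).

Lemma mu_prim i : mu (emb (prim i)) = ~~ mu (emb i).
Proof. by case: i. Qed.

Lemma prim_inv : involutive (@prim n).
Proof. by case. Qed.

Lemma hom_T_H e d a b : hom e a -> hom d b -> hom (~~ e (+) d) (T_H e a b).
Proof.
move=> ha hb; rewrite T_HE; apply: hom_sum => i _; apply: homZ => //.
apply: hom_eq (hom_mul (hom_pd _ ha) (hom_pd _ hb)) _.
by rewrite mu_prim; case: (mu _) (e) (d) => [] [] [].
Qed.

Lemma T_H_sym e d a b : hom e a -> hom d b ->
  T_H d b a = - ((-1) ^+ (~~ e && ~~ d) *: T_H e a b).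
Proof.
move=> ha hb; rewrite !T_HE (reindex_inj (inv_inj prim_inv)) scaler_sumr -sumrN.
apply: eq_bigr => i _; rewrite prim_inv mu_prim.
rewrite (scomm_hom (hom_pd _ hb) (hom_pd _ ha)) mu_prim !scalerA -scaleNr.
by congr (_ *: _); case: (mu _) (e) (d) => [] [] [] /=; ring.
Qed.

Lemma pd_T_H r e a b : hom e a -> pd r (T_H e a b) =
  T_H (mu r (+) e) (pd r a) b + (-1) ^+ (mu r && ~~ e) *: T_H e a (pd r b).
Proof.
move=> ha; rewrite !T_HE linear_sum scaler_sumr -big_split; apply: eq_bigr => i _.
rewrite /= pdZ pd_mul // (hom_sg _ (hom_pd _ ha)) (pd_comm r) (pd_comm r (emb i)).
rewrite mu_prim !(omulZl, omulZr); case: (mu _) (mu _) (e) => [] [] [] /=; module_ring.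
Qed.

Lemma eul_T_H e a b :
  eul (T_H e a b) = T_H e (eul a) b + T_H e a (eul b) - T_H e a b *+ 2.
Proof.
rewrite !T_HE linear_sum mulr2n opprD -!sumrN -!big_split; apply: eq_bigr => i _.
rewrite /= endZ eul_mul // !pd_eul_emb // omulDl omulDr; module_ring.
Qed.

Lemma T_H_xvar e a i :
  T_H e a (xvar (emb i)) = (-1) ^+ (mu (emb (prim i)) && e) *: pd (emb (prim i)) a.
Proof.
rewrite T_HE (bigD1 i) //= pd_xvar // eqxx scale1r omul1r big1 ?addr0 // => j ji.
by rewrite pd_xvar // (inj_eq emb_inj) (negPf ji) scale0r omul0r scaler0.
Qed.

Lemma T_H_last e a : T_H e a (xvar z) = 0.
Proof.
by rewrite T_HE big1 // => i _; rewrite pd_xvar // emb_neq_last scale0r omul0r scaler0.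
Qed.

Lemma dkE e a b : dko e a b =
  T_H e a b + (-1) ^+ e *: (pd z a ** eul b) + (eul a - a *+ 2) ** pd z b.
Proof. by rewrite /D_KO_formula !add_lfunE scale_lfunE !comp_lfunE. Qed.

Lemma hom_eul2 e a : hom e a -> hom e (eul a - a *+ 2).
Proof. by move=> ha; rewrite mulr2n; apply/homB/homD => //; apply: hom_eul. Qed.

Lemma hom_dko e d a b : hom e a -> hom d b -> hom (~~ e (+) d) (dko e a b).
Proof.
move=> ha hb; rewrite dkE; apply: homD => //; first apply: homD => //.
- exact: hom_T_H.
- apply: homZ => //; apply: hom_eq (hom_mul (hom_pd _ ha) (hom_eul hb)) _ => //.
apply: hom_eq (hom_mul (hom_eul2 ha) (hom_pd _ hb)) _ => //=.
by case: (e) (d) => [] [].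
Qed.

Lemma T_H_mul e a b c : hom e a ->
  T_H e a (b ** c) = T_H e a b ** c + sg (~~ e) b ** T_H e a c.
Proof.
move=> ha; rewrite !T_HE omul_suml omul_sumr -big_split; apply: eq_bigr => i _.
rewrite /= pd_mul // omulDr !omulA scalerDr omulZl omulZr; congr (_ + _ *: _).
rewrite (scomm _ (hom_pd _ ha)) sg_sg -!omulA; congr (sg _ _ ** _).
by rewrite mu_prim; case: (mu _) (e) => [] [].
Qed.

Lemma dko_mul e a b c : hom e a ->
  dko e a (b ** c) = dko e a b ** c + sg (~~ e) b ** dko e a c.
Proof.
move=> ha; rewrite !dkE T_H_mul // eul_mul pd_mul.
have hg := hom_eul2 ha; have hz : hom (~~ e) (pd z a) := hom_pd z ha.
move: (eul a - a *+ 2) hg => g hg.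
rewrite !(omulDl, omulDr, omulZl, omulZr) !omulA.
rewrite (scomm (sg _ b) hg) (scomm b hz) sg_sg addbT; module_ring.
Qed.

(* Unlike a general superderivation of a divided power algebra, a special one
   is determined by its values on the variables. *)
Definition special D : Prop := forall a, D a = \sum_r D (xvar r) ** pd r a.

Lemma sum_var (f : var_index n -> O) : \sum_r f r = \sum_i f (emb i) + f z.
Proof.
rewrite !big_sumType /= big_ord_recr /= addrA; congr (_ + _ + _).
by apply: eq_bigr => i _; congr (f (inr _)); apply/ord_inj/esym/lift_max.
Qed.

Lemma dko_xvar e a i : dko e a (xvar (emb i)) =
  (-1) ^+ (mu (emb (prim i)) && e) *: pd (emb (prim i)) a
  + (-1) ^+ e *: (pd z a ** xvar (emb i)).
Proof.
rewrite dkE T_H_xvar eul_xvar // pd_xvar // eq_sym emb_neq_last scale0r omul0r.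
by rewrite addr0.
Qed.

Lemma dko_last e a : dko e a (xvar z) = eul a - a *+ 2.
Proof.
by rewrite dkE T_H_last eul_last // pd_xvar // eqxx scale1r omul0r omul1r scaler0 !add0r.
Qed.

Lemma special_dko e a : special (dko e a).
Proof.
move=> b; rewrite dkE sum_var dko_last; congr (_ + _).
rewrite T_HE eulE omul_sumr scaler_sumr -big_split; apply: eq_bigr => i _ /=.
by rewrite dko_xvar omulDl !omulZl omulA.
Qed.

(** The commutator of two special superderivations is again special, so identities between
    commutators can be tested on the variables. *)
Lemma special_comm e d D E : special D -> special E ->
    (forall a b, D (a ** b) = D a ** b + sg e a ** D b) ->
    (forall a b, E (a ** b) = E a ** b + sg d a ** E b) ->
    (forall m a, hom m a -> hom (e (+) m) (D a)) ->
    (forall m a, hom m a -> hom (d (+) m) (E a)) ->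
  forall a, D (E a) - (-1) ^+ (e && d) *: E (D a) =
    \sum_r (D (E (xvar r)) - (-1) ^+ (e && d) *: E (D (xvar r))) ** pd r a.
Proof.
move=> sD sE dD dE hD hE a.
have expand f D' E' : special D' -> special E' ->
    (forall a b, D' (a ** b) = D' a ** b + sg f a ** D' b) ->
    D' (E' a) = \sum_r D' (E' (xvar r)) ** pd r a +
      \sum_r \sum_s sg f (E' (xvar r)) ** (D' (xvar s) ** pd s (pd r a)).
  move=> sD' sE' dD'; rewrite [E' a]sE' linear_sum -big_split; apply: eq_bigr => r _.
  by rewrite /= dD' (sD' (pd r a)) omul_sumr.
rewrite (expand _ _ _ sD sE dD) (expand _ _ _ sE sD dE) scalerDr opprD addrACA.
rewrite -[RHS]addr0; congr (_ + _).
  rewrite scaler_sumr -sumrB; apply: eq_bigr => r _.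
  by rewrite omulBl omulZl.
(* The terms with two derivatives cancel: exchanging the two values and exchanging the two
   derivatives produce signs that compensate. *)
rewrite exchange_big scaler_sumr -sumrB big1 // => r _ /=.
rewrite scaler_sumr -sumrB big1 // => s _.
rewrite !omulA (hom_sg e (hE _ _ (hom_xvar s))) (hom_sg d (hD _ _ (hom_xvar r))).
rewrite !omulZl (scomm_hom (hE _ _ (hom_xvar s)) (hD _ _ (hom_xvar r))) pd_comm.
rewrite omulZl omulZr !scalerA -scalerBl (_ : _ - _ = 0) ?scale0r //.
by case: (e) (d) (mu r) (mu s) => [] [] [] [] /=; ring.
Qed.

Lemma brk_last e d a b : hom e a -> hom d b ->
  dko e a (eul b - b *+ 2) - (-1) ^+ (~~ e && ~~ d) *: dko d b (eul a - a *+ 2)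
  = eul (brk e a b) - brk e a b *+ 2.
Proof.
move=> ha hb; have hz := hom_pd z.
rewrite /brk !dkE !mulr2n !(endB, endD) !endZ !eul_T_H !eul_mul !(endB, endD) !pd_eul_last.
rewrite (T_H_sym (hom_eul ha) hb) (T_H_sym ha hb).
(* These commutations bring every product into the order with the factor from [a] first; what
   remains is linear in the products. *)
have c1 := scomm_hom (hz _ _ hb) (hom_eul (hom_eul ha)).
have c2 := scomm_hom (hz _ _ hb) (hom_eul ha).
have c3 := scomm_hom (hom_eul hb) (hom_eul (hz _ _ ha)).
have c4 := scomm_hom (hom_eul hb) (hz _ _ ha).
have c5 := scomm_hom hb (hom_eul (hz _ _ ha)).
have c6 := scomm_hom hb (hz _ _ ha).
move: c1 c2 c3 c4 c5 c6; generalize_values => c1 c2 c3 c4 c5 c6.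
rewrite !(omulDl, omulDr, omulBl, omulBr, omulNl, omulNr) c1 c2 c3 c4 c5 c6.
generalize_products; clear; apply/ffunP => B; rewrite !superO_coordE.
by case: e d => [] [] /=; ring.
Qed.

End ContactBracket.

(** * The commutator of two contact fields *)

Section ContactCommutator.

Implicit Types (i : var_index2 n).

Lemma pd_last_brk e a b : hom e a ->
  pd z (brk e a b) = brk (~~ e) (pd z a) b + (-1) ^+ (~~ e) *: brk e a (pd z b).
Proof.
move=> ha; rewrite /brk !mulr2n pdB !pdD !pdZ (pd_T_H z b ha) !pd_mul !pdB !pdD.
rewrite !pd_eul_last !pd_pd_last !end0 !(omul0l, omul0r).
rewrite (hom_sg _ (hom_pd z ha)).
rewrite !(omulDl, omulDr, omulBl, omulBr, omulZl, omulZr, omulNl, omulNr).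
by case: e ha => _ /=; module_ring.
Qed.

Lemma brk_xvar e d a b i : hom e a -> hom d b ->
  dko e a (dko d b (xvar (emb i)))
  - (-1) ^+ (~~ e && ~~ d) *: dko d b (dko e a (xvar (emb i)))
  = dko (~~ e (+) d) (brk e a b) (xvar (emb i)).
Proof.
move=> ha hb; have hz := hom_pd z; have hq := hom_pd (emb (prim i)).
rewrite !dko_xvar !(endD (dko _ _)) !(endZ (dko _ _)).
rewrite (dko_mul (pd z b) _ ha) (dko_mul (pd z a) _ hb) !dko_xvar pd_last_brk //.
have Eq c : pd (emb (prim i)) (eul c) = eul (pd (emb (prim i)) c) + pd (emb (prim i)) c.
  exact: pd_eul_emb.
(* Once this derivative and this variable are abstracted, the identity depends on i only through a
   parity, so even and odd variables are treated together. *)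
move: (emb (prim i)) (xvar (emb i)) hq Eq => q x hq Eq.
rewrite (hom_sg _ (hz _ _ ha)) (hom_sg _ (hz _ _ hb)) /brk !mulr2n.
rewrite !(pdD q) !(pdN q) !(pdZ q) (pd_T_H q b ha) !(pd_mul q) !(pdB q) !(pdD q) !Eq.
rewrite (pd_comm q z a) (pd_comm q z b) (hom_sg _ (hz _ _ ha)) (endB (sg _)) (endD (sg _)).
rewrite (hom_sg _ ha) (hom_sg _ (hom_eul ha)) !dkE !pd_pd_last !mulr2n.
rewrite (T_H_sym (hq _ _ ha) hb) (T_H_sym (hz _ _ ha) hb).
have c1 := scomm_hom (hz _ _ hb) (hom_eul (hq _ _ ha)).
have c2 := scomm_hom (hom_eul hb) (hz _ _ (hq _ _ ha)).
have c3 := scomm_hom hb (hz _ _ (hq _ _ ha)).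
have c4 := scomm_hom (hz _ _ hb) (hom_eul (hz _ _ ha)).
have c5 := scomm_hom (hz _ _ hb) (hz _ _ ha).
have c6 := scomm_hom (hz _ _ hb) (hq _ _ ha).
move: c1 c2 c3 c4 c5 c6; move: (mu q) => m; generalize_values.
move=> c1 c2 c3 c4 c5 c6.
rewrite !(omulDl, omulDr, omulBl, omulBr, omulZl, omulZr, omulNl, omulNr,
  omul0r, omul0l, omulA).
rewrite c1 c2 c3 c4 c5 c6 !omulZl; generalize_products.
clear; apply/ffunP => B; rewrite !superO_coordE.
by case: m e d => [] [] [] /=; ring.
Qed.

(** By [special_comm] both sides are determined by their values on the variables, which [brk_xvar]
    and [brk_last] compare. *)
Lemma dko_bracket e d a b y : hom e a -> hom d b ->
  dko e a (dko d b y) - (-1) ^+ (~~ e && ~~ d) *: dko d b (dko e a y)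
  = dko (~~ e (+) d) (brk e a b) y.
Proof.
move=> ha hb; rewrite (@special_comm (~~ e) (~~ d)); first last.
- by move=> m f hf; apply: hom_dko.
- by move=> m f hf; apply: hom_dko.
- by move=> f g; apply: dko_mul.
- by move=> f g; apply: dko_mul.
- exact: special_dko.
- exact: special_dko.
rewrite [RHS]special_dko; apply: eq_bigr => r _; congr (_ ** _).
have [[i ->]|->] := var_cases r; first exact: brk_xvar.
by rewrite !dko_last brk_last.
Qed.

End ContactCommutator.

(** * The superbracket of fields and injectivity of [D_KO] *)

Section BracketOfFields.

Implicit Types (i : var_index2 n) (D E : 'End(O)).

Definition pure_op m D : Prop := forall d a, hom d a -> hom (m (+) d) (D a).

Lemma par_proj_pure e d a : hom d a -> par_proj F p t e a = (d == e)%:R *: a.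
Proof.
move/pureP => ha; rewrite [a]superO_basis linear_sum scaler_sumr.
apply: eq_bigr => B _; rewrite /= endZ ext_xbas scalerA mulrC -scalerA.
have [->|/ha ->] := eqVneq (a B) 0; first by rewrite !scale0r.
by case: eqP; rewrite ?scale1r ?scale0r.
Qed.

Lemma par_comp_pure e m D : pure_op m D -> par_comp e D = (m == e)%:R *: D.
Proof.
move=> hD; apply: lfun_xbasP => B; rewrite scale_lfunE sum_lfunE.
have hB := hom_xbas B; move: (parity B) hB => d hB.
rewrite (bigD1 d) //= !comp_lfunE (par_proj_pure _ hB) eqxx scale1r.
rewrite (par_proj_pure _ (hD _ _ hB)) (inj_eq (@addIb d)) big1 ?addr0 // => f fd.
by rewrite !comp_lfunE (par_proj_pure _ hB) eq_sym (negPf fd) scale0r !end0.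
Qed.

Local Opaque par_comp.

Lemma sbracket_pure m e D E : pure_op m D -> pure_op e E ->
  sbracket D E = ((D \o E) - (-1) ^+ (m && e) *: (E \o D))%VF.
Proof.
move=> hD hE; have cD d := par_comp_pure d hD; have cE d := par_comp_pure d hE.
pose S d f := ((par_comp d D \o par_comp f E)
  - (-1) ^+ (d * f)%N *: (par_comp f E \o par_comp d D))%VF.
have -> : sbracket D E = S true true + S true false + (S false true + S false false).
  by apply: etrans (big_bool _ _) _; congr (_ + _); apply: big_bool.
rewrite /S !mulnb /= !cD !cE; case: m e {hD hE cD cE S} => [] [] /=;
  by rewrite !scale1r ?scale0r ?(comp_lfun0r, comp_lfun0l, scaler0, oppr0, addr0, add0r).
Qed.

Lemma DKO_pure e a : hom e a -> DKO a = dko e a.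
Proof. by move=> ha; apply/D_KOE/pureP. Qed.

Lemma sbracket_DKO e d a b : hom e a -> hom d b ->
  sbracket (DKO a) (DKO b) = DKO (brk e a b).
Proof.
move=> ha hb; have hc : hom (~~ e (+) d) (brk e a b).
  apply: homB; last first.
    by apply: homZ; apply: hom_eq (hom_mul (hom_pd z ha) hb) _.
  by have := hom_dko ha hb; rewrite dkE.
rewrite (DKO_pure ha) (DKO_pure hb) (DKO_pure hc).
rewrite (@sbracket_pure (~~ e) (~~ d)); try by move=> f x hx; apply: hom_dko.
apply: lfun_xbasP => B.
by rewrite -(dko_bracket _ ha hb) add_lfunE opp_lfunE scale_lfunE !comp_lfunE.
Qed.

(** With both arguments in the kernel of [cdiv k], only the bracket term of [cdiv_mul] survives. *)
Lemma sbracket_DKO_cdiv k e d a b : hom e a -> hom d b -> cdiv k a = 0 -> cdiv k b = 0 ->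
  sbracket (DKO a) (DKO b) = (-1) ^+ e *: DKO (cdiv (k + 2%:R) (a ** b)).
Proof.
move=> ha hb ka kb; rewrite (sbracket_DKO ha hb) (cdiv_mul k b ha) ka kb.
rewrite omul0l omul0r scaler0 !add0r -linearZ /= scalerA -expr2 sqrr_sign.
by rewrite scale1r.
Qed.

Definition par_part (e : bool) a : O := (2%:R : F)^-1 *: (a + (-1) ^+ e *: sg true a).

Lemma par_part_pure e a : hom e (par_part e a).
Proof.
rewrite /par_part /pure endZ endD endZ sgK !scalerA mulrC -scalerA; congr (_ *: _).
by rewrite scalerDr scalerA -expr2 sqrr_sign scale1r addrC.
Qed.

Lemma par_part_sum a : par_part false a + par_part true a = a.
Proof.
rewrite /par_part -scalerDr expr1 expr0 scale1r scaleN1r addrACA subrr addr0.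
by rewrite -mulr2n -scaler_nat scalerA mulVf // scale1r.
Qed.

Lemma pure_both e a : hom e a -> hom (~~ e) a -> a = 0.
Proof.
rewrite /pure => -> E; apply: eq_opp0.
by case: e E; rewrite /= expr0 expr1 scale1r scaleN1r.
Qed.

(** The value at z gives [eul a] = 2 a, hence [eul (pd z a)] = 2 [pd z a]. Differentiating the
    values at the other variables by z shows that their derivatives kill [pd z a], so [eul] does too
    and [pd z a] = 0. Then these derivatives kill [a] itself, and 2 a = [eul a] = 0. *)
Lemma dko_inj e a : hom e a -> (forall r, dko e a (xvar r) = 0) -> a = 0.
Proof.
move=> ha h; have hz := h z; rewrite dko_last in hz.
have e2 : eul a = 2%:R *: a by apply/eqP; rewrite -subr_eq0 scaler_nat hz.
have hi i : (-1) ^+ (mu (emb (prim i)) && e) *: pd (emb (prim i)) a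
  + (-1) ^+ e *: (pd z a ** xvar (emb i)) = 0 by rewrite -dko_xvar h.
have pz : pd z a = 0.
  have pi i : pd (emb i) (pd z a) = 0.
    have := congr1 (pd z) (hi (prim i)); rewrite pd0 pdD !pdZ pd_mul pd_pd_last.
    rewrite pd_xvar eq_sym emb_neq_last scale0r omul0l omul0r addr0 scaler0 addr0.
    rewrite prim_inv (pd_comm z) scalerA => /eqP; rewrite scaler_eq0 mulf_eq0.
    by rewrite !signr_eq0 => /eqP.
  have := pd_eul_last a; rewrite e2 pdZ [RHS]eulE big1 => [/eqP|i _].
    by rewrite scaler_eq0 (negPf h2) => /eqP.
  by rewrite pi omul0r.
suff : 2%:R *: a = 0 by move/eqP; rewrite scaler_eq0 (negPf h2) => /eqP.
rewrite -e2 eulE big1 // => i _; have := hi (prim i).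
rewrite pz omul0l scaler0 addr0 prim_inv => /eqP.
by rewrite scaler_eq0 signr_eq0 => /eqP ->; rewrite omul0r.
Qed.

Lemma DKO_inj : injective DKO.
Proof.
suff inj0 a : DKO a = 0 -> a = 0.
  move=> a b ab; apply/eqP; rewrite -subr_eq0; apply/eqP/inj0.
  by rewrite linearB /= ab subrr.
move=> a0; have h0 := par_part_pure false a; have h1 := par_part_pure true a.
have split b : dko false (par_part false a) b + dko true (par_part true a) b = 0.
  have E : DKO a = dko false (par_part false a) + dko true (par_part true a).
    by rewrite -(DKO_pure h0) -(DKO_pure h1) -linearD par_part_sum.
  by rewrite -add_lfunE -E a0 zero_lfunE.
(* The values of the two parity parts at a variable have opposite parities and sum to zero, so both
   vanish. *)
have dko0 e r : dko e (par_part e a) (xvar r) = 0.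
  have hr := hom_xvar r; apply: (@pure_both (~~ e (+) mu r)).
    exact: hom_dko (par_part_pure e a) hr.
  have -> : dko e (par_part e a) (xvar r) = - dko (~~ e) (par_part (~~ e) a) (xvar r).
    apply/eqP; rewrite -addr_eq0; case: e => /=; last by rewrite split.
    by rewrite addrC split.
  apply: homN; apply: hom_eq (hom_dko (par_part_pure (~~ e) a) hr) _.
  by case: e (mu r) => [] [].
by rewrite -[a]par_part_sum (dko_inj h0 (dko0 _)) (dko_inj h1 (dko0 _)) addr0.
Qed.

End BracketOfFields.

Local Notation nabla := (nabla F p t).
Local Notation X := (Xmon F p t).
Local Notation top := (top_index p t).
Local Notation c := (n%:R * lam).
Local Notation zeta := (xvar z).
Local Notation g1 := (bracketv (SKO2 p t lam) (SKO2 p t lam)).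
Local Notation zdX A := (n%:R - (2 * #|A|)%:R : F).

(** * Homology of Delta *)

Section DeltaHomology.

Implicit Types (i l : 'I_n) (j : 'I_n.+1) (A : {set 'I_n}).

Lemma xmon_coord al u B : xm al u B != 0 -> (forall i, B.1 i = al i :> nat) /\ B.2 = u.
Proof.
rewrite ffunE; case: andP => [[/forallP h /eqP <-] _|_]; last by rewrite eqxx.
by split=> // i; apply/eqP.
Qed.

Lemma pos_top i : (0 < top i)%N.
Proof. by rewrite subn_gt0; apply: pexpn_gt1. Qed.

Lemma top_lt i : (top i < p ^ t i)%N.
Proof. by rewrite /top_index subn1 prednK // (ltnW (pexpn_gt1 i)). Qed.

Lemma lt_top B i : (B.1 i <= top i)%N.
Proof. by rewrite /top_index subn1 -ltnS prednK ?(ltnW (pexpn_gt1 i)). Qed.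

Lemma top_natr i : (top i)%:R = -1 :> F.
Proof.
rewrite natrB ?(ltnW (pexpn_gt1 i)) // natrX (pcharf0 hp) expr0n.
by rewrite eqn0Ngt ht sub0r.
Qed.

Lemma xvar_pd_inl i a B : (xvar (inl i) ** pd (inl i) a) B = (B.1 i)%:R * a B :> F.
Proof.
elim/superO_ind: a => [|k a b ha hb|C].
- by rewrite pd0 omul0r superO_coordE mulr0.
- by rewrite pdD pdZ omulDr omulZr !superO_coordE ha hb; ring.
rewrite /xbas pd_inl_xmon // omulZr; case: posnP => [C0|C0].
  rewrite scale0r superO_coordE -/(xbas F C) xbasE; case: eqP => [->|_].
    by rewrite C0 mul0r.
  by rewrite mulr0.
rewrite scale1r /xvar mul_xmon osgn0l mul1r set0U superO_coordE.
rewrite (_ : xm _ _ = xbas F C); last first.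
  apply: xmon_congr => // l; rewrite /unit_index; case: eqP => [->|_]; last by rewrite subn0.
  by rewrite add1n subn1 prednK.
rewrite -/(xbas F C) xbasE; case: eqP => [->|_]; rewrite ?mulr0 // !mulr1.
rewrite /mulbin (bigD1 i) //= big1 => [|l li].
  by rewrite /unit_index eqxx muln1 bin1 add1n subn1 prednK.
by rewrite /unit_index (negPf li) bin0.
Qed.

Lemma xvar_pd_inr j a B : (xvar (inr j) ** pd (inr j) a) B = (j \in B.2)%:R * a B :> F.
Proof.
elim/superO_ind: a => [|k a b ha hb|C].
- by rewrite pd0 omul0r superO_coordE mulr0.
- by rewrite pdD pdZ omulDr omulZr !superO_coordE ha hb; ring.
rewrite /xbas pd_inr_xmon omulZr /xvar mul_xmon -/(xbas F C) !superO_coordE xbasE.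
have [jC|jC] := boolP (j \in C.2); last first.
  rewrite !mul0r; case: eqP => [->|_]; rewrite ?mulr0 // (negPf jC) mul0r //.
rewrite (_ : xm _ _ = xbas F C); last first.
  by apply: xmon_congr => [l|]; rewrite ?setD1K.
rewrite /osgn disjoint1 !inE eqxx /= /mulbin big1 => [|l _]; last by rewrite bin0.
rewrite xbasE; case: eqP => [->|_]; rewrite ?mulr0 // jC.
have := osignK F [set j] (C.2 :\ j); rewrite -{1}osign_self setD1K // => K.
by rewrite !mul1r !mulr1.
Qed.

Lemma eul_coord a B :
  eul a B = (\sum_i B.1 i + #|[set i | lift ord_max i \in B.2]|)%:R * a B :> F.
Proof.
rewrite eulE big_sumType /= superO_coordE !sum_ffunE natrD mulrDl; congr (_ + _).
  rewrite natr_sum mulr_suml; apply: eq_bigr => i _; exact: xvar_pd_inl.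
rewrite -sum1_card natr_sum mulr_suml [RHS]big_mkcond; apply: eq_bigr => i _ /=.
by rewrite xvar_pd_inr inE; case: ifP; rewrite ?mul0r.
Qed.

Lemma pd_inl_coord i a B : B.1 i = top i :> nat -> pd (inl i) a B = 0.
Proof.
move=> Bi; elim/superO_ind: a => [|k a b ha hb|C].
- by rewrite pd0 superO_coordE.
- by rewrite pdD pdZ !superO_coordE ha hb mulr0 addr0.
rewrite /xbas pd_inl_xmon // superO_coordE.
have [->|/xmon_coord[E _]] := eqVneq (xm (fun l => C.1 l - unit_index i l)%N C.2 B) 0.
  by rewrite mulr0.
case: posnP => [_|C0]; first by rewrite mul0r.
move: (E i); rewrite Bi /unit_index eqxx => {}E.
by have := lt_top C i; rewrite E; have := C0; lia.
Qed.

Lemma pd_inr_coord j a B : j \in B.2 -> pd (inr j) a B = 0.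
Proof.
move=> Bj; elim/superO_ind: a => [|k a b ha hb|C].
- by rewrite pd0 superO_coordE.
- by rewrite pdD pdZ !superO_coordE ha hb mulr0 addr0.
rewrite /xbas pd_inr_xmon // superO_coordE.
have [->|/xmon_coord[_ E]] := eqVneq (xm (fun l => C.1 l) (C.2 :\ j) B) 0.
  by rewrite mulr0.
by move: Bj; rewrite E !inE eqxx.
Qed.

Lemma pd_inr_eq0 j a B : pd (inr j) a = 0 -> j \in B.2 -> a B = 0.
Proof.
move=> a0 jB; have := xvar_pd_inr j a B.
by rewrite a0 omul0r jB mul1r => <-; rewrite superO_coordE.
Qed.

(** Integration in x_i: the exponent is raised without the integer factor that multiplication by x_i
    would bring. *)
Definition up i : 'End(O) := ext (fun B => xm (fun l => B.1 l + unit_index i l)%N B.2).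

Lemma up_xbas i B : up i (xbas F B) = xm (fun l => B.1 l + unit_index i l)%N B.2.
Proof. exact: ext_xbas. Qed.

Lemma up_xmon i al u : up i (xm al u) = xm (fun l => al l + unit_index i l)%N u.
Proof.
have [[B [hB <-] ->]|[l hl ->]] := xmonP F p t al u.
  by rewrite up_xbas; apply: xmon_congr => // l; rewrite hB.
by rewrite end0 (@xmon_out _ _ _ _ _ _ l) // (leq_trans hl) // leq_addr.
Qed.

Lemma pd_inr_up i j a : pd (inr j) (up i a) = up i (pd (inr j) a).
Proof.
elim/superO_ind: a => [|k a b ha hb|B].
- by rewrite end0 pd0 end0.
- by rewrite pdD pdZ !(endD (up i)) !(endZ (up i)) pdD pdZ ha hb.
by rewrite up_xbas /xbas !pd_inr_xmon endZ up_xmon.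
Qed.

Lemma pd_inl_up i l a : l != i -> pd (inl l) (up i a) = up i (pd (inl l) a).
Proof.
move=> li; elim/superO_ind: a => [|k a b ha hb|B].
- by rewrite end0 pd0 end0.
- by rewrite pdD pdZ !(endD (up i)) !(endZ (up i)) pdD pdZ ha hb.
have e : unit_index i l = 0%N by rewrite /unit_index (negPf li).
rewrite up_xbas /xbas !pd_inl_xmon ?e ?addn0 // endZ up_xmon.
case: posnP => [_|B0]; rewrite ?scale0r // !scale1r; apply: xmon_congr => // q.
rewrite addnBAC // /unit_index; case: eqP => // ->; exact: B0.
Qed.

Lemma pd_up i B u (al := fun l => B.1 l) :
  pd (inl i) (up i (xm al u)) = (al i != top i :> nat)%:R *: xm al u.
Proof.
rewrite up_xmon; have e : unit_index i i = 1%N by rewrite /unit_index eqxx.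
have := lt_top B i; have := pexpn_gt1 i; rewrite /al /top_index => p1.
case: eqP => [Bi _|Bi Bt].
  by rewrite (@xmon_out _ _ _ _ _ _ i) ?pd0 ?scale0r // e Bi subnK // ltnW.
rewrite pd_inl_xmon e addn1; last by lia.
by congr (_ *: _); apply: xmon_congr => // l; rewrite addnK.
Qed.

Lemma up_pd i B u (al := fun l => B.1 l) :
  up i (pd (inl i) (xm al u)) = (0 < al i)%N%:R *: xm al u.
Proof.
rewrite /al pd_inl_xmon // endZ up_xmon; case: posnP => [_|B0]; rewrite ?scale0r //.
congr (_ *: _); apply: xmon_congr => // l; rewrite /unit_index; case: eqP => [->|_].
  by rewrite subnK.
by rewrite subn0 addn0.
Qed.

Lemma nablaE i a : nabla i a = xvar (emb (inr i)) ** up i a.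
Proof.
elim/superO_ind: a => [|k a b ha hb|B]; first by rewrite !end0.
  rewrite !(endD (nabla i), endD (up i)) !(endZ (nabla i), endZ (up i)).
  by rewrite omulDr omulZr ha hb.
rewrite ext_xbas up_xbas (scomm _ (hom_xmon _ _)) cards0 sg0 -omulA mul_xmon.
rewrite osgn0l set0U /mulbin big1 => [|l _]; last by rewrite addn0 binn.
by rewrite mulr1 scale1r; congr (_ ** _); apply: xmon_congr => // l; rewrite addn0.
Qed.

(* The homology in the variables x_i and x_i' is spanned by x_i' and x_i^(pi_i). *)
Definition xtype i B :=
  if lift ord_max i \in B.2 then B.1 i == 0%N :> nat else B.1 i == top i :> nat.

Definition ddop i a : O := pd (emb (inl i)) (pd (emb (inr i)) a).

Lemma ddopE i a : DeltaI F p t i a = ddop i a.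
Proof. by rewrite comp_lfunE. Qed.

Lemma Delta_dd a : Delta a = \sum_i ddop i a.
Proof. exact: DeltaE. Qed.

Lemma ddop_nabla i l a : l != i -> ddop l (nabla i a) = - nabla i (ddop l a).
Proof.
move=> li; rewrite !nablaE /ddop pd_mul pd_xvar (inj_eq emb_inj).
rewrite (_ : inr l == inr i :> var_index2 n = false); last exact: negPf.
rewrite scale0r omul0l add0r (hom_sg _ (hom_xvar _)) omulZl expr1 scaleN1r pdN.
by rewrite pd_mul pd_xvar (inj_eq emb_inj) scale0r omul0l add0r sg0 pd_inr_up pd_inl_up.
Qed.

(** If x_i' occurs, [nabla i] kills the monomial, and [nabla i] after [ddop i] returns it unless the
    exponent of x_i is zero. If x_i' is absent, [ddop i] kills it, and the other composite returns
    it unless that exponent is maximal. *)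
Lemma ddop_nabla_self i B :
  ddop i (nabla i (xbas F B)) + nabla i (ddop i (xbas F B)) = (~~ xtype i B)%:R *: xbas F B.
Proof.
rewrite !nablaE /ddop pd_mul pd_xvar eqxx scale1r omul1l.
rewrite (hom_sg _ (hom_xvar _)) omulZl expr1 scaleN1r pdB pd_mul pd_xvar (inj_eq emb_inj).
rewrite scale0r omul0l add0r sg0 pd_inr_up pd_up /xtype.
have [iB|iB] := boolP (lift ord_max i \in B.2); last first.
  rewrite {2 3}/xbas pd_inr_xmon (negPf iB) mul0r scale0r !(end0, pd0).
  by rewrite subr0 addr0.
have xd : xvar (emb (inr i)) ** pd (emb (inr i)) (xbas F B) = xbas F B.
  apply/ffunP => C; rewrite xvar_pd_inr xbasE.
  by case: eqP => [->|_]; rewrite ?mulr0 // iB mul1r.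
rewrite -/(xbas F B); move: xd; set W := pd (inr (lift ord_max i)) _ => xd.
have hW : W = osign F [set lift ord_max i] B.2 *:
    xm (fun l => B.1 l) (B.2 :\ lift ord_max i).
  by rewrite /W /xbas pd_inr_xmon iB mul1r.
have uW : up i (pd (inl i) W) = ((0 < B.1 i)%N)%:R *: W.
  by rewrite hW pdZ endZ up_pd !scalerA mulrC.
have Wu : pd (inl i) (up i W) = (B.1 i != top i :> nat)%:R *: W.
  by rewrite hW endZ pdZ pd_up !scalerA mulrC.
by rewrite Wu uW !omulZr xd subrr add0r lt0n.
Qed.

Lemma Delta_nabla i B :
  Delta (nabla i (xbas F B)) + nabla i (Delta (xbas F B)) = (~~ xtype i B)%:R *: xbas F B.
Proof.
rewrite !Delta_dd linear_sum -big_split (bigD1 i) //= ddop_nabla_self big1 ?addr0 //.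
by move=> l li; rewrite ddop_nabla // addNr.
Qed.

Definition restr (Q : pred (mon p t)) : 'End(O) := ext (fun B => (Q B)%:R *: xbas F B).

Lemma restr_coord Q a B : restr Q a B = (Q B)%:R * a B :> F.
Proof.
elim/superO_ind: a => [|k a b ha hb|C].
- by rewrite end0 superO_coordE mulr0.
- by rewrite endD endZ !superO_coordE ha hb; ring.
rewrite ext_xbas superO_coordE xbasE.
by case: eqP => [->|_]; rewrite ?mulr0.
Qed.

Local Notation keep i := (restr (xtype i)).

(** The projection to the monomials of type [xtype i] is homotopic to the identity, with homotopy
    [nabla i]. *)
Lemma restr_xtypeE i a : keep i a = a - (Delta (nabla i a) + nabla i (Delta a)).
Proof.
elim/superO_ind: a => [|k a b ha hb|B].
- by rewrite !end0 addr0 subr0.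
- rewrite !(endD (keep i), endD Delta, endD (nabla i)).
  rewrite !(endZ (keep i), endZ Delta, endZ (nabla i)) ha hb; module_ring.
rewrite Delta_nabla ext_xbas; case: (xtype i B); rewrite ?scale1r ?scale0r ?subr0 //.
by rewrite subrr.
Qed.

Lemma pd_last_nabla i a : pd z (nabla i a) = - nabla i (pd z a).
Proof.
rewrite !nablaE pd_mul pd_xvar eq_sym emb_neq_last scale0r omul0l add0r.
by rewrite (hom_sg _ (hom_xvar _)) omulZl expr1 scaleN1r pd_inr_up.
Qed.

Lemma Delta_pd_last a : Delta (pd z a) = - pd z (Delta a).
Proof. by rewrite Delta_pd expr1 scaleN1r. Qed.

(** Induction over the indices: adding [nabla i] of the closed remainder to [b] applies the
    projection for i to this remainder. *)
Lemma xtype_homotopy (s : seq 'I_n) a : Delta a = 0 -> pd z a = 0 ->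
  exists2 b, pd z b = 0 & forall B, (a - Delta b) B = (all (xtype^~ B) s)%:R * a B :> F.
Proof.
move=> da za; elim: s => [|i s [b zb hb]].
  by exists 0 => [|B]; rewrite ?pd0 // end0 subr0 mul1r.
have Df : Delta (a - Delta b) = 0 by rewrite endB da Delta_Delta subr0.
have zf : pd z (a - Delta b) = 0.
  by rewrite pdB za -[pd z _]opprK -Delta_pd_last zb end0 oppr0 subr0.
exists (b + nabla i (a - Delta b)) => [|B].
  by rewrite pdD zb pd_last_nabla zf end0 oppr0 addr0.
have -> : a - Delta (b + nabla i (a - Delta b)) = keep i (a - Delta b).
  by rewrite restr_xtypeE Df (end0 (nabla i)) addr0 (endD Delta b) opprD addrA.
by rewrite restr_coord hb mulrA -natrM mulnb.
Qed.

Lemma Xlt A i : ((if i \in A then top i else 0) < p ^ t i)%N.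
Proof. by case: ifP => _; [apply: top_lt | apply/ltnW/pexpn_gt1]. Qed.

Definition XB A : mon p t :=
  ([ffun i => Ordinal (Xlt A i)] : mindex p t, [set lift ord_max i | i in ~: A]).

Lemma XB1 A i : (XB A).1 i = (if i \in A then top i else 0%N) :> nat.
Proof. by rewrite ffunE. Qed.

Lemma XB2 A : (XB A).2 = [set lift ord_max i | i in ~: A].
Proof. by []. Qed.

Lemma lift_in A i : (lift ord_max i \in [set lift ord_max l | l in A]) = (i \in A).
Proof. by rewrite mem_imset //; apply: lift_inj. Qed.

Lemma last_notin A : ord_max \notin [set lift ord_max l | l in A].
Proof. by apply/imsetP => -[l _ /eqP]; rewrite (negPf (neq_lift _ _)). Qed.

Lemma XmonE A : X A = xbas F (XB A).
Proof. by apply: xmon_congr => // i; rewrite XB1. Qed.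

Lemma XB_xtype A i : xtype i (XB A).
Proof. by rewrite /xtype XB1 XB2 lift_in inE; case: (i \in A); rewrite /= eqxx. Qed.

Lemma XB_inj : injective XB.
Proof.
move=> A A' /(congr1 snd) /= /setP E; apply/setP => i.
by have := E (lift ord_max i); rewrite !lift_in !inE => /negb_inj.
Qed.

Lemma set_lift u : ord_max \notin u ->
  u = [set lift ord_max i | i in [set i | lift ord_max i \in u]].
Proof.
move=> nu; apply/setP => j; case: (unliftP ord_max j) => [i ->|->].
  by rewrite lift_in inE.
by rewrite (negPf nu) (negPf (last_notin _)).
Qed.

(** The monomials surviving the projections for all indices are, apart from those containing z,
    exactly the X. *)
Lemma xtypeP B : (forall i, xtype i B) -> ord_max \notin B.2 ->
  B = XB [set i | lift ord_max i \notin B.2].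
Proof.
move=> xB zB; apply/eqP; rewrite -pair_eqE /pair_eq /=; apply/andP; split; last first.
  have E : ~: [set i | lift ord_max i \notin B.2] = [set i | lift ord_max i \in B.2].
    by apply/setP => i; rewrite !inE negbK.
  by rewrite E -set_lift.
apply/eqP/ffunP => i; apply: ord_inj; rewrite ffunE /= inE.
by have := xB i; rewrite /xtype; case: ifP => _ /eqP.
Qed.

Lemma homology a : Delta a = 0 -> pd z a = 0 ->
  exists2 b, pd z b = 0 & a = Delta b + \sum_A a (XB A) *: X A.
Proof.
move=> da za; have [b zb hb] := xtype_homotopy (enum 'I_n) da za.
exists b => //; apply/eqP; rewrite addrC -subr_eq; apply/eqP/ffunP => B; rewrite hb.
rewrite sum_ffunE; under eq_bigr => A _ do rewrite superO_coordE XmonE xbasE.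
have [xB|] := boolP (all (xtype^~ B) (enum 'I_n)); last first.
  move/allPn => [i _ ni]; rewrite mul0r big1 // => A _; case: eqP => [E|_].
    by move: ni; rewrite E XB_xtype.
  by rewrite mulr0.
have {}xB i : xtype i B by apply: (allP xB); rewrite mem_enum.
rewrite mul1r; have [zB|zB] := boolP (ord_max \in B.2).
  rewrite (pd_inr_eq0 za zB) big1 // => A _; case: eqP => [E|_]; last by rewrite mulr0.
  by move: zB; rewrite E (negPf (last_notin _)).
rewrite {1}(xtypeP xB zB); set A := [set i | _].
rewrite (bigD1 A) //= (xtypeP xB zB) -/A eqxx mulr1 big1 ?addr0 // => A' A'A.
by rewrite (inj_eq XB_inj) eq_sym (negPf A'A) mulr0.
Qed.

(** The image of [ddop i] involves only monomials without x_i' and with non-maximal exponent at i;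
    type [xtype i] contradicts one of the two. *)
Lemma Delta_coord a B : (forall i, xtype i B) -> Delta a B = 0.
Proof.
move=> xB; rewrite Delta_dd sum_ffunE big1 // => i _.
have := xB i; rewrite /xtype /ddop; case: ifP => [iB _|_ /eqP iB]; last exact: pd_inl_coord.
by rewrite pd_comm /= scale1r; apply: pd_inr_coord.
Qed.

Lemma ddop_X i A : ddop i (X A) = 0.
Proof.
rewrite /ddop XmonE; have [iA|iA] := boolP (i \in A).
  rewrite [pd (emb (inr i)) _](_ : _ = 0) ?pd0 //.
  by rewrite /xbas /= pd_inr_xmon lift_in inE iA mul0r scale0r.
rewrite pd_comm /= scale1r [pd (inl i) _](_ : _ = 0) ?pd0 //.
by rewrite /xbas pd_inl_xmon // XB1 (negPf iA) scale0r.
Qed.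

Lemma Delta_X A : Delta (X A) = 0.
Proof. by rewrite Delta_dd big1 // => i _; apply: ddop_X. Qed.

Lemma nabla_X i A : nabla i (X A) = 0.
Proof.
rewrite nablaE XmonE up_xbas; have [iA|iA] := boolP (i \in A).
  rewrite (@xmon_out _ _ _ _ _ _ i) ?omul0r // XB1 iA /unit_index eqxx.
  by rewrite subnK // ltnW // pexpn_gt1.
by rewrite mul_xmon /osgn disjoint1 XB2 lift_in inE iA mul0r scale0r.
Qed.

Lemma pd_last_X A : pd z (X A) = 0.
Proof.
by rewrite XmonE /xbas /= pd_inr_xmon (negPf (last_notin _)) mul0r scale0r.
Qed.

(** A maximal exponent is -1 in F, so each index in [A] contributes -1 and each index outside
    contributes 1. *)
Lemma zd_X A : (zd (fun i => (XB A).1 i) (~: A))%:R = n%:R - (2 * #|A|)%:R :> F.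
Proof.
rewrite natrD natr_sum (eq_bigr (fun i => - (i \in A)%:R)) => [|i _]; last first.
  by rewrite XB1; case: (i \in A); rewrite ?top_natr ?oppr0.
rewrite sumrN -natr_sum -big_mkcond sum1_card.
have -> : n%:R = #|A|%:R + #|~: A|%:R :> F by rewrite -natrD cardsC card_ord.
rewrite natrM; ring.
Qed.

Lemma eul_X A : eul (X A) = (n%:R - (2 * #|A|)%:R) *: X A.
Proof.
apply/ffunP => B; rewrite eul_coord superO_coordE XmonE xbasE.
case: eqP => [->|_]; rewrite ?mulr0 // !mulr1 -zd_X.
by rewrite (_ : [set i | _] = ~: A) //; apply/setP => i; rewrite inE lift_in.
Qed.

End DeltaHomology.

(** * The derived algebra *)

Section DerivedAlgebra.

Implicit Types (i l : 'I_n) (j : 'I_n.+1) (A : {set 'I_n}).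

(** Injectivity of [D_KO] turns membership into an equation for the function; the sign in [div_lam]
    amounts to a twist by the parity automorphism. *)
Lemma mem_SKO2 a : (DKO a \in SKO2 p t lam) = (cdiv c a == 0).
Proof.
rewrite -memv_ker /SKO2; apply/memv_imgP/idP => [[b kb /DKO_inj ->]|ka].
  move: kb; rewrite !memv_ker div_lam_cdiv cdiv_sg scalerA scaler_eq0 mulf_eq0 (negPf h2).
  rewrite signr_eq0 => /eqP E.
  by rewrite -[cdiv c b](sgK true) E end0.
exists a => //; rewrite memv_ker div_lam_cdiv cdiv_sg.
by move: ka; rewrite memv_ker => /eqP ->; rewrite end0 !scaler0.
Qed.

Lemma SKO2P D : D \in SKO2 p t lam -> exists2 a, cdiv c a = 0 & D = DKO a.
Proof.
move=> hD; have /memv_imgP[a _ E] := hD; exists a => //.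
by apply/eqP; rewrite -mem_SKO2 -E.
Qed.

Lemma cdiv_par_part k e a : cdiv k a = 0 -> cdiv k (par_part e a) = 0.
Proof.
move=> ka; rewrite /par_part (endZ (cdiv k)) (endD (cdiv k)) (endZ (cdiv k)) cdiv_sg ka.
by rewrite end0 !scaler0 addr0 scaler0.
Qed.

(** The bracket formula read backwards; splitting [b] into its parity parts makes a sum of both
    parities admissible. *)
Lemma derived_prod e a b : hom e a -> cdiv c a = 0 -> cdiv c b = 0 ->
  DKO (cdiv (c + 2%:R) (a ** b)) \in g1.
Proof.
move=> ha ka kb.
have pure_prod d f : hom d f -> cdiv c f = 0 -> DKO (cdiv (c + 2%:R) (a ** f)) \in g1.
  move=> hf kf; have E := sbracket_DKO_cdiv ha hf ka kf.
  have -> : DKO (cdiv (c + 2%:R) (a ** f)) = (-1) ^+ e *: sbracket (DKO a) (DKO f).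
    by rewrite E scalerA -expr2 sqrr_sign scale1r.
  apply: memvZ; apply: ((bracketP _ _ _).2 (subvv _)); first by rewrite mem_SKO2 ka.
  by rewrite mem_SKO2 kf.
rewrite -[b]par_part_sum omulDr (endD (cdiv _)) linearD /=.
by apply: memvD; apply: pure_prod (par_part_pure _ _) (cdiv_par_part _ _).
Qed.

(** The criterion for upper bounds on the derived algebra: by bilinearity it suffices to treat
    homogeneous functions. *)
Lemma derived_sub (V : {vspace 'End(O)}) :
  (forall e d a b, hom e a -> hom d b -> cdiv c a = 0 -> cdiv c b = 0 ->
     DKO (cdiv (c + 2%:R) (a ** b)) \in V) -> (g1 <= V)%VS.
Proof.
move=> hV; apply/bracketP => D E /SKO2P[a ka ->] /SKO2P[b kb ->].
have pure_br e d f g : hom e f -> hom d g -> cdiv c f = 0 -> cdiv c g = 0 ->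
    sbracket (DKO f) (DKO g) \in V.
  by move=> hf hg kf kg; rewrite (sbracket_DKO_cdiv hf hg kf kg) memvZ // (hV _ _ _ _ hf hg).
have addl f g h : sbracket (DKO (f + g)) h = sbracket (DKO f) h + sbracket (DKO g) h.
  by have := sbracketPl h 1 (DKO f) (DKO g); rewrite !scale1r linearD.
have addr f g h : sbracket h (DKO (f + g)) = sbracket h (DKO f) + sbracket h (DKO g).
  by have := sbracketPr h 1 (DKO f) (DKO g); rewrite !scale1r linearD.
rewrite -[a]par_part_sum -[b]par_part_sum addl !addr.
by do !apply: memvD; apply: pure_br (par_part_pure _ _) (par_part_pure _ _)
  (cdiv_par_part _ ka) (cdiv_par_part _ kb).
Qed.

Lemma pd_last_zeta a : pd z a = 0 -> pd z (zeta ** a) = a.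
Proof. by move=> za; rewrite pd_mul pd_xvar eqxx scale1r omul1l za omul0r addr0. Qed.

Lemma Delta_zeta a : Delta (zeta ** a) = - (zeta ** Delta a).
Proof.
rewrite !Delta_dd omul_sumr -sumrN; apply: eq_bigr => i _; rewrite /ddop.
rewrite pd_mul pd_xvar emb_neq_last scale0r omul0l add0r (hom_sg _ (hom_xvar _)) /=.
rewrite expr1 scaleN1r omulNl pdN pd_mul -[inl i]/(emb (inl i)) pd_xvar emb_neq_last.
by rewrite scale0r omul0l add0r sg0.
Qed.

Lemma cdiv_free k a : pd z a = 0 -> cdiv k a = Delta a.
Proof. by move=> za; rewrite cdivE za end0 scaler0 subr0 addr0. Qed.

Lemma cdiv_zeta k a : pd z a = 0 ->
  cdiv k (zeta ** a) = - (zeta ** Delta a) + (eul a - k *: a).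
Proof. by move=> za; rewrite cdivE Delta_zeta pd_last_zeta. Qed.

(** For [a] free of z this is a solution of [cdiv c] whose part containing z is -z [Delta a]; it
    extends Delta-exact leading parts to solutions. *)
Definition cdivz a : O := cdiv (c + 2%:R) (zeta ** a).

Lemma cdiv_cdivz a : cdiv c (cdivz a) = 0.
Proof. exact: cdiv_cdiv. Qed.

Lemma pd_last_cdivz a : pd z a = 0 -> pd z (cdivz a) = - Delta a.
Proof. by move=> za; rewrite pd_cdiv pd_last_zeta. Qed.

Lemma cdiv_one k : cdiv k one = 0.
Proof.
rewrite cdiv_free ?pd_one // Delta_dd big1 // => i _.
by rewrite /ddop !pd_one pd0.
Qed.

Lemma hom_one : hom false one.
Proof. by have := hom_xmon (fun=> 0%N) set0; rewrite cards0. Qed.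

Lemma cdiv_shift k a : cdiv (k + 2%:R) a = cdiv k a - pd z a *+ 2.
Proof. by have E := cdivE k a; rewrite [LHS]cdivE E; module_ring. Qed.

(** * A spanning set of the kernel of [cdiv c] *)

Section SpanningSet.

Variable i1 : 'I_n.
Local Notation x1 := (xvar (emb (inl i1))).
Local Notation y1 := (xvar (emb (inr i1))).

Lemma hom_xx : hom true (x1 ** y1).
Proof. exact: hom_mul (hom_xvar _) (hom_xvar _). Qed.

Lemma xx_X A : x1 ** y1 ** X A = 0.
Proof.
rewrite XmonE /xvar /= mul_xmon omulZl mul_xmon set0U.
have [iA|iA] := boolP (i1 \in A).
  rewrite (@xmon_out _ _ _ _ _ _ i1) ?scaler0 // XB1 iA /unit_index eqxx addn0.
  by rewrite addnC subnK // ltnW // pexpn_gt1.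
by rewrite /osgn disjoint1 XB2 lift_in inE iA mul0r scale0r scaler0.
Qed.

(* The bracket with weight_elt multiplies X A by zdX A - (c + 2), up to sign. *)
Definition weight_elt : O := zeta + c *: (x1 ** y1).

Lemma hom_weight_elt : hom true weight_elt.
Proof. by apply: homD (hom_xvar _) _; apply: homZ; apply: hom_xx. Qed.

Lemma pd_last_xx : pd z (x1 ** y1) = 0.
Proof.
by rewrite pd_mul !pd_xvar !(eq_sym z) !emb_neq_last !scale0r omul0l omul0r addr0.
Qed.

Lemma pd_last_weight_elt : pd z weight_elt = one.
Proof. by rewrite pdD pdZ pd_last_xx scaler0 addr0 pd_xvar eqxx scale1r. Qed.

Lemma Delta_xx : Delta (x1 ** y1) = one.
Proof.
have E l : pd (emb (inr l)) (x1 ** y1) = (l == i1)%:R *: x1.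
  rewrite pd_mul !pd_xvar !(inj_eq emb_inj) scale0r omul0l add0r omulZr omul1r.
  by rewrite (hom_sg _ (hom_xvar _)) andbF scale1r.
rewrite Delta_dd (bigD1 i1) //= big1 => [|l li]; rewrite /ddop E.
  by rewrite eqxx scale1r pd_xvar eqxx scale1r addr0.
by rewrite (negPf li) scale0r pd0.
Qed.

Lemma eul_one : eul one = 0.
Proof. by rewrite eulE big1 // => i _; rewrite pd_one omul0r. Qed.

(** [Delta] sends x_1 x_1' to 1, and the coefficient c compensates the term -c coming from z. *)
Lemma cdiv_weight_elt : cdiv c weight_elt = 0.
Proof.
rewrite cdivE pd_last_weight_elt eul_one /weight_elt endD (endZ Delta) Delta_xx.
rewrite Delta_dd big1 => [|l _]; first by module_ring.
by rewrite /ddop pd_xvar emb_neq_last scale0r pd0.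
Qed.

(** [V] stands for a candidate right-hand side of the decomposition; the hypotheses below add step
    by step what the derived algebra may miss. *)
Variable V : {vspace 'End(O)}.
Hypothesis g1V : (g1 <= V)%VS.

(** The product of 1 and [cdivz b] is a solution of [cdiv c], so [cdiv (c + 2)] reduces on it to -2
    [pd z], which gives 2 [Delta b]. *)
Lemma exact_in b : pd z b = 0 -> DKO (Delta b) \in V.
Proof.
move=> zb; have := derived_prod hom_one (cdiv_one c) (cdiv_cdivz b).
move/(subvP g1V); rewrite omul1l cdiv_shift cdiv_cdivz pd_last_cdivz // sub0r mulNrn opprK.
by rewrite -scaler_nat linearZ /= => /(memvZ (2%:R)^-1); rewrite scalerA mulVf // scale1r.
Qed.

Lemma X_in A : zdX A != c + 2%:R -> DKO (X A) \in V.
Proof.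
move=> zA; have KX : cdiv c (X A) = 0 by rewrite cdiv_free ?pd_last_X ?Delta_X.
have := derived_prod hom_weight_elt cdiv_weight_elt KX; move/(subvP g1V).
rewrite omulDl omulZl xx_X scaler0 addr0 cdiv_zeta ?pd_last_X // Delta_X omul0r oppr0 add0r.
rewrite eul_X -scalerBl linearZ /= => /(memvZ (zdX A - (c + 2%:R))^-1).
by rewrite scalerA mulVf ?subr_eq0 // scale1r.
Qed.

Hypothesis XV : forall A, zdX A = c + 2%:R -> DKO (X A) \in V.

Lemma free_in a : cdiv c a = 0 -> pd z a = 0 -> DKO a \in V.
Proof.
move=> ka za; rewrite cdiv_free // in ka; have [b zb ->] := homology ka za.
rewrite linearD linear_sum /=; apply: memvD; first exact: exact_in.
apply: memv_suml => A _; rewrite linearZ /= memvZ //.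
by case: (eqVneq (zdX A) (c + 2%:R)) => [/XV|/X_in].
Qed.

(** Solutions with the same derivative by z differ by a solution free of z, which [free_in] handles;
    so only the parts containing z need to be compared. *)
Lemma free_diff a b : cdiv c a = 0 -> cdiv c b = 0 -> pd z a = pd z b ->
  DKO a \in V -> DKO b \in V.
Proof.
move=> ka kb zab aV; rewrite -[b](subrK a) linearD /= memvD // free_in //.
  by rewrite (endB (cdiv c)) ka kb subrr.
by rewrite pdB zab subrr.
Qed.

Lemma Delta_xvar (i : var_index2 n) : Delta (xvar (emb i)) = 0.
Proof.
rewrite Delta_dd big1 // => l _; rewrite /ddop pd_xvar pdZ pd_one scaler0 //.
Qed.

Lemma T_H_xvarl (i : var_index2 n) a :
  T_H (mu (emb (prim i))) (xvar (emb (prim i))) a =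
    (-1) ^+ mu (emb (prim i)) *: pd (emb i) a.
Proof.
rewrite T_HE (bigD1 i) //= big1 => [|l li].
  by rewrite pd_xvar eqxx scale1r omul1l andbb addr0.
rewrite pd_xvar (inj_eq emb_inj) (inj_eq (inv_inj prim_inv)) (negPf li).
by rewrite scale0r omul0l scaler0.
Qed.

(** The bracket with the conjugate variable acts as [pd (emb i)] up to sign, so its result and
    [cdivz] of the derivative agree after [pd z]. *)
Lemma cdivz_pd_in (i : var_index2 n) b : pd z b = 0 -> DKO (cdivz (pd (emb i) b)) \in V.
Proof.
move=> zb; set q := emb (prim i).
have Kx : cdiv c (xvar q) = 0.
  by rewrite cdiv_free ?Delta_xvar // pd_xvar eq_sym emb_neq_last scale0r.
have := derived_prod (hom_xvar q) Kx (cdiv_cdivz b); move/(subvP g1V).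
apply: free_diff; [exact: cdiv_cdiv | exact: cdiv_cdivz | ].
have zd : pd z (pd (emb i) b) = 0 by rewrite pd_comm zb pd0 scaler0.
rewrite pd_cdiv pd_mul pd_xvar eq_sym emb_neq_last scale0r omul0l add0r pd_last_cdivz //.
rewrite pd_last_cdivz // (hom_sg _ (hom_xvar _)) omulZl omulNr endZ endN.
rewrite (Delta_mul _ (hom_xvar _)) Delta_xvar omul0l Delta_Delta omul0r scaler0 !add0r.
rewrite T_H_xvarl Delta_pd /q mu_prim; case: (mu (emb i)) => /=; module_ring.
Qed.

Definition topO : O := xm top [set lift ord_max i | i in [set: 'I_n]].

Lemma top_coord B : topO B != 0 ->
  (forall i, B.1 i = top i :> nat) /\ B.2 = [set lift ord_max i | i in [set: 'I_n]].
Proof. exact: xmon_coord. Qed.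

Lemma pd_last_top : pd z topO = 0.
Proof. by rewrite /= pd_inr_xmon (negPf (last_notin _)) mul0r scale0r. Qed.

(** In F each maximal exponent -1 cancels against one odd variable, so the top monomial has degree
    zero. *)
Lemma sum_top : (\sum_i top i + n)%:R = 0 :> F.
Proof.
rewrite natrD natr_sum (eq_bigr (fun=> -1)) => [|i _]; last exact: top_natr.
by rewrite sumr_const card_ord mulNrn addNr.
Qed.

Lemma eul_top : eul topO = 0.
Proof.
apply/ffunP => B; rewrite eul_coord superO_coordE.
have [->|/top_coord[B1 B2]] := eqVneq (topO B) 0; first by rewrite mulr0.
rewrite (eq_bigr (fun i => top i)) => [|i _]; last exact: B1.
rewrite (_ : [set i | _] = setT) ?cardsT ?card_ord ?sum_top ?mul0r //.
by apply/setP => i; rewrite B2 inE lift_in.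
Qed.

Lemma xvar_pd_top_inr i : xvar (emb (inr i)) ** pd (emb (inr i)) topO = topO.
Proof.
apply/ffunP => B; rewrite xvar_pd_inr.
have [->|/top_coord[_ ->]] := eqVneq (topO B) 0; first by rewrite mulr0.
by rewrite lift_in inE mul1r.
Qed.

Lemma xvar_pd_top_inl i : xvar (emb (inl i)) ** pd (emb (inl i)) topO = - topO.
Proof.
apply/ffunP => B; rewrite xvar_pd_inl superO_coordE.
have [->|/top_coord[-> _]] := eqVneq (topO B) 0; first by rewrite mulr0 oppr0.
by rewrite top_natr mulN1r.
Qed.

(** Only the summand of [Delta] at i1 contributes: in the others x_1' remains in the monomial and
    meets the factor x_1'. *)
Lemma xx_Delta_top : x1 ** y1 ** Delta topO = - topO.
Proof.
have E l : x1 ** y1 ** ddop l topO = (l == i1)%:R *: - topO.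
  have {1}-> : ddop l topO = pd (emb (inl l)) (pd (emb (inr l)) topO) by [].
  have -> f : x1 ** y1 ** pd (emb (inl l)) f = x1 ** pd (emb (inl l)) (y1 ** f).
    by rewrite pd_mul pd_xvar (inj_eq emb_inj) scale0r omul0l add0r sg0 omulA.
  have [->|li] := eqVneq l i1; first by rewrite xvar_pd_top_inr xvar_pd_top_inl scale1r.
  have y0 : y1 ** topO = 0.
    by rewrite /xvar mul_xmon /osgn disjoint1 lift_in inE mul0r scale0r.
  (* Differentiating the relation x_1' T = 0 shows that x_1' also kills the derivative of T by
     x_l'. *)
  have := congr1 (pd (emb (inr l))) y0; rewrite pd0 pd_mul pd_xvar (inj_eq emb_inj).
  rewrite -[inr l == _]/(l == i1) (negPf li) scale0r omul0l add0r (hom_sg _ (hom_xvar _)).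
  rewrite omulZl expr1 scaleN1r => /eqP; rewrite oppr_eq0 => /eqP ->.
  by rewrite pd0 omul0r scale0r.
rewrite Delta_dd omul_sumr (bigD1 i1) //= E eqxx scale1r big1 ?addr0 // => l li.
by rewrite E (negPf li) scale0r.
Qed.

Lemma cdivz_top : cdivz topO = - (zeta ** Delta topO) - (c + 2%:R) *: topO.
Proof. by rewrite /cdivz cdiv_zeta ?pd_last_top // eul_top sub0r. Qed.

(** After [pd z], the bracket with [weight_elt] is -2 (c + 1) times [cdivz topO]; this factor is
    invertible, and [free_diff] removes the remaining difference. *)
Lemma cdivz_top_in : c + 1 != 0 -> DKO (cdivz topO) \in V.
Proof.
move=> c1; have := derived_prod hom_weight_elt cdiv_weight_elt (cdiv_cdivz topO).
move/(subvP g1V).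
set m := cdiv _ _ => mV.
have zE : pd z (weight_elt ** cdivz topO) = - ((2%:R * (c + 1)) *: topO).
  rewrite pd_mul pd_last_weight_elt omul1l (hom_sg _ hom_weight_elt).
  rewrite pd_last_cdivz ?pd_last_top //.
  rewrite cdivz_top omulZl omulNr /weight_elt omulDl omulZl xx_Delta_top; module_ring.
have zm : pd z m = - (2%:R * (c + 1)) *: pd z (cdivz topO).
  rewrite /m pd_cdiv zE pd_last_cdivz ?pd_last_top // (endN Delta) (endZ Delta).
  module_ring.
have c2 : - (2%:R * (c + 1)) != 0 by rewrite oppr_eq0 mulf_neq0.
apply: (free_diff (a := (- (2%:R * (c + 1)))^-1 *: m)).
- by rewrite (endZ (cdiv c)) cdiv_cdiv scaler0.
- exact: cdiv_cdivz.
- by rewrite pdZ zm scalerA mulVf // scale1r.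
by rewrite linearZ memvZ.
Qed.

Lemma cdiv_zeta_X A : zdX A = c -> cdiv c (zeta ** X A) = 0.
Proof.
move=> zA; rewrite cdiv_zeta ?pd_last_X // Delta_X omul0r oppr0 add0r eul_X zA.
exact: subrr.
Qed.

Lemma hom_X A : hom (odd #|~: A|) (X A).
Proof.
have := hom_xbas (XB A); rewrite -XmonE /parity XB2 card_imset //.
exact: lift_inj.
Qed.

(** The exponents of complementary X never overlap, so all binomials are 1 and the constant is a
    sign. *)
Lemma X_mul_setC A : exists2 k, k != 0 & X A ** X (~: A) = k *: topO.
Proof.
rewrite !XmonE mul_xbas !XB2 setCK /osgn.
have d : [disjoint [set lift ord_max i | i in ~: A] & [set lift ord_max i | i in A]].
  rewrite -setI_eq0 -imsetI; last by move=> i l _ _; apply: lift_inj.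
  by rewrite setIC setICr imset0.
exists (osign F [set lift ord_max i | i in ~: A] [set lift ord_max i | i in A]).
  exact: osign_neq0.
rewrite d -imsetU setUC setUCr /mulbin big1 ?mulr1 => [|i _].
  congr (_ *: _); apply: xmon_congr => // i; rewrite !XB1 inE.
  by case: (i \in A); rewrite ?addn0.
by rewrite !XB1 inE; case: (i \in A); rewrite ?addn0 ?binn ?bin0.
Qed.

(** If z X solves [cdiv c], multiplying it by the complementary X gives z T up to a sign, hence
    [cdivz topO] as a bracket. *)
Lemma cdivz_top_in_X A : zdX A = c -> DKO (cdivz topO) \in V.
Proof.
move=> zA; have hX := hom_mul (hom_xvar z) (hom_X A).
have KX : cdiv c (X (~: A)) = 0 by rewrite cdiv_free ?pd_last_X ?Delta_X.
have := derived_prod hX (cdiv_zeta_X zA) KX; move/(subvP g1V).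
have [k k0 E] := X_mul_setC A.
rewrite -omulA E omulZr (endZ (cdiv _)) linearZ /= => /(memvZ k^-1).
by rewrite scalerA mulVf // scale1r.
Qed.

Lemma pd_last_xbas B : ord_max \notin B.2 -> pd z (xbas F B) = 0.
Proof. by move=> zB; rewrite /xbas /= pd_inr_xmon (negPf zB) mul0r scale0r. Qed.

Lemma pd_last_up i a : pd z (up i a) = up i (pd z a).
Proof. exact: pd_inr_up. Qed.

(** A non-maximal exponent can be integrated and a missing odd variable multiplied in; only T allows
    neither. *)
Lemma xbas_top_or_pd B : ord_max \notin B.2 ->
  xbas F B = topO \/
  exists i : var_index2 n, exists2 b, pd z b = 0 & xbas F B = pd (emb i) b.
Proof.
move=> zB; have zb := pd_last_xbas zB.
have [/forallP Bt|] := boolP [forall i, B.1 i == top i :> nat]; last first.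
  rewrite negb_forall => /existsP[i Bi]; right; exists (inl i), (up i (xbas F B)).
    by rewrite pd_last_up zb end0.
  by rewrite /= pd_up Bi scale1r.
have [/forallP Bu|] := boolP [forall i, lift ord_max i \in B.2]; last first.
  rewrite negb_forall => /existsP[i Bi]; right.
  exists (inr i), (xvar (emb (inr i)) ** xbas F B).
    by rewrite pd_mul pd_xvar eq_sym emb_neq_last scale0r omul0l zb omul0r addr0.
  rewrite pd_mul pd_xvar eqxx scale1r omul1l [pd _ (xbas F B)](_ : _ = 0) ?omul0r ?addr0 //.
  by rewrite /xbas /= pd_inr_xmon (negPf Bi) mul0r scale0r.
left; apply: xmon_congr => [i|]; first exact/eqP.
rewrite (set_lift zB); congr [set lift ord_max i | i in mem (_ : {set 'I_n})].
by apply/setP => i; rewrite !inE Bu.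
Qed.

Hypothesis topV : DKO (cdivz topO) \in V.

Lemma cdivz_in b : pd z b = 0 -> DKO (cdivz b) \in V.
Proof.
move=> zb; rewrite [b]superO_basis /cdivz omul_sumr linear_sum linear_sum.
apply: memv_suml => B _ /=; have [zB|zB] := boolP (ord_max \in B.2).
  by rewrite (pd_inr_eq0 zb zB) scale0r omul0r end0 linear0 mem0v.
rewrite omulZr (endZ (cdiv _)) linearZ memvZ //=.
by have [->|[i [b' zb' ->]]] := xbas_top_or_pd zB; [exact: topV | exact: cdivz_pd_in].
Qed.

(** The derivative by z of a solution is Delta-closed. By [homology] it is an exact part, removed by
    [cdivz b], plus a combination of X, removed by the z X of weight c. *)
Lemma cdiv_split a : cdiv c a = 0 -> exists (g : {set 'I_n} -> F) (b : O),
  [/\ forall A, g A != 0 -> zdX A = c, pd z b = 0,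
      cdiv c (a - \sum_A g A *: (zeta ** X A) + cdivz b) = 0
    & pd z (a - \sum_A g A *: (zeta ** X A) + cdivz b) = 0].
Proof.
move=> ka; have zza := pd_pd_last a.
have Dza : Delta (pd z a) = 0.
  by apply/eqP; rewrite -oppr_eq0 -(pd_cdiv c) ka pd0.
have [b zb E] := homology Dza zza.
(* At X A the equation [cdiv c a = 0] has no contribution from [Delta], so [zdX A - c] times the
   coefficient of [pd z a] is zero. *)
have gE A : pd z a (XB A) != 0 -> zdX A = c.
  have := congr1 (fun f : O => f (XB A)) ka.
  rewrite cdivE !superO_coordE Delta_coord; last exact: XB_xtype.
  rewrite add0r eul_coord -mulNr -mulrDl => /eqP; rewrite mulf_eq0.
  case/orP => [|/eqP ->]; last by rewrite eqxx.
  rewrite (_ : [set i | _] = ~: A); last by apply/setP => i; rewrite inE lift_in.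
  by rewrite -/(zd _ _) zd_X subr_eq0 => /eqP.
exists (fun A => pd z a (XB A)), b; split=> //.
  rewrite (endD (cdiv c)) (endB (cdiv c)) ka cdiv_cdivz linear_sum /=.
  rewrite big1 ?subr0 ?addr0 // => A _.
  rewrite (endZ (cdiv c)); have [->|/gE/cdiv_zeta_X ->] := eqVneq (pd z a (XB A)) 0.
    by rewrite scale0r.
  exact: scaler0.
have -> : pd z (a - \sum_A pd z a (XB A) *: (zeta ** X A) + cdivz b) =
    pd z a - \sum_A pd z a (XB A) *: X A - Delta b.
  rewrite pdD pdB pd_last_cdivz //; congr (_ - _ + _); rewrite linear_sum.
  by apply: eq_bigr => A _; rewrite /= pdZ pd_last_zeta ?pd_last_X.
by rewrite {1}E addrK subrr.
Qed.

Hypothesis zXV : forall A, zdX A = c -> DKO (zeta ** X A) \in V.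

Lemma cdiv_in a : cdiv c a = 0 -> DKO a \in V.
Proof.
move=> ka; have [g [b [hg zb kd zd]]] := cdiv_split ka.
have dV := free_in kd zd; set s := \sum_A _ in kd zd dV *.
have -> : a = (a - s + cdivz b) + s - cdivz b by rewrite [a - s + _]addrAC subrK addrK.
rewrite linearB linearD /=; apply: memvB; last exact: cdivz_in.
apply: memvD => //; rewrite /s linear_sum; apply: memv_suml => A _.
rewrite linearZ /=; have [->|/hg zA] := eqVneq (g A) 0; first by rewrite scale0r mem0v.
exact/memvZ/zXV.
Qed.

End SpanningSet.

End DerivedAlgebra.

(** * The decomposition *)

Section Decomposition.

Implicit Types (i l : 'I_n) (j : 'I_n.+1) (A : {set 'I_n}) (Q : pred (mon p t)).

(** With [supported], complementary coordinate subspaces transported to fields; directness of the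
    sums is tested on coordinates. *)
Definition vanishing Q : {vspace 'End(O)} := (DKO @: lker (restr Q))%VS.
Definition supported Q : {vspace 'End(O)} := (DKO @: lker (restr (predC Q)))%VS.

Lemma mem_vanishing Q a : reflect (forall B, Q B -> a B = 0) (DKO a \in vanishing Q).
Proof.
apply: (iffP memv_imgP) => [[b + /DKO_inj ->] B QB|Qa].
  rewrite memv_ker => /eqP/(congr1 (fun f : O => f B)).
  by rewrite restr_coord QB superO_coordE mul1r.
exists a => //; rewrite memv_ker; apply/eqP/ffunP => B.
rewrite restr_coord superO_coordE.
by case: (boolP (Q B)) => [/Qa ->|_]; rewrite ?mulr0 ?mul0r.
Qed.

Lemma mem_supported Q a : (forall B, a B != 0 -> Q B) -> DKO a \in supported Q.
Proof.
move=> Qa; apply/mem_vanishing => B /= nQ; apply/eqP; apply: contraNT nQ; exact: Qa.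
Qed.

Lemma vanishing_supported Q D : D \in vanishing Q -> D \in supported Q -> D = 0.
Proof.
move=> + /memv_imgP[b + DE]; rewrite {}DE memv_ker => /mem_vanishing Qb /eqP cb.
suff -> : b = 0 by rewrite linear0.
apply/ffunP => B; rewrite superO_coordE; have [/Qb //|nQ] := boolP (Q B).
have := congr1 (fun f : O => f B) cb.
by rewrite restr_coord superO_coordE /= nQ mul1r.
Qed.

Lemma supported_vanishing Q Q' : (forall B, Q B -> ~~ Q' B) ->
  (supported Q <= vanishing Q')%VS.
Proof.
move=> QQ'; apply/subvP => D /memv_imgP[b + ->]; rewrite memv_ker => /eqP cb.
apply/mem_vanishing => B Q'B; have := congr1 (fun f : O => f B) cb.
rewrite restr_coord superO_coordE /=; have [/QQ'|_] := boolP (Q B); first by rewrite Q'B.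
by rewrite mul1r.
Qed.

Definition zdB B : nat := (\sum_i B.1 i + #|[set i | lift ord_max i \in B.2]|)%N.

Definition S_mon B := [forall i, xtype i B] && (ord_max \in B.2).
Definition X_mon B :=
  [&& [forall i, xtype i B], ord_max \notin B.2 & (zdB B)%:R == c + 2%:R].

(** [Delta] has no coordinate of this type, and the other part of [cdiv] is free of z. *)
Lemma cdiv_S_mon k a B : S_mon B -> cdiv k a B = 0.
Proof.
case/andP => /forallP xB zB; rewrite cdivE !superO_coordE Delta_coord // eul_coord.
by rewrite pd_inr_coord //; ring.
Qed.

(** Here [Delta] has no coordinate, and [eul - (c + 2)] acts on the monomial by zero. *)
Lemma cdiv_X_mon a B : X_mon B -> cdiv (c + 2%:R) a B = 0.
Proof.
case/and3P => /forallP xB _ /eqP zB; rewrite cdivE !superO_coordE Delta_coord // eul_coord.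
by rewrite -/(zdB B) zB; ring.
Qed.

Lemma derived_S_mon : (g1 <= vanishing S_mon)%VS.
Proof.
by apply: derived_sub => e d a b _ _ _ _; apply/mem_vanishing => B; apply: cdiv_S_mon.
Qed.

Lemma derived_X_mon : (g1 <= vanishing X_mon)%VS.
Proof.
by apply: derived_sub => e d a b _ _ _ _; apply/mem_vanishing => B; apply: cdiv_X_mon.
Qed.

Lemma zeta_X_coord A B : (zeta ** X A) B != 0 -> S_mon B.
Proof.
rewrite XmonE /xvar mul_xmon superO_coordE mulf_eq0 negb_or => /andP[_ /xmon_coord[B1 B2]].
apply/andP; split; last by rewrite B2 !inE eqxx.
apply/forallP => i; have := XB_xtype A i; rewrite /xtype B1 B2 !inE.
by rewrite [lift _ _ == _]eq_sym (negPf (neq_lift _ _)).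
Qed.

Lemma X_coord A B : zdX A = c + 2%:R -> X A B != 0 -> X_mon B.
Proof.
move=> zA; rewrite XmonE xbasE; have [-> _|_] := eqVneq B (XB A); last by rewrite eqxx.
apply/and3P; split; [by apply/forallP => i; apply: XB_xtype | exact: last_notin |].
rewrite -zA -zd_X /zd /zdB (_ : [set i | _] = ~: A) //.
by apply/setP => i; rewrite inE lift_in.
Qed.

Lemma X_zeta A : X A ** zeta = (-1) ^+ (odd #|~: A|) *: (zeta ** X A).
Proof. by rewrite (scomm_hom (hom_X A) (hom_xvar z)) andbT. Qed.

Lemma S5P D : D \in S5 p t lam -> exists2 A : {set 'I_n}, zdX A = c & D = DKO (X A ** zeta).
Proof.
case/mapP => -[al u]; rewrite mem_filter => /andP[/and3P[/eqP I0 /eqP J0 /eqP zc] _] ->.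
rewrite /= in I0 J0 zc *; pose B : mon p t := (al, [set lift ord_max i | i in u]).
have mB : xmon2 F p t (fun i => al i) u = xbas F B by [].
(* Both index sets being empty, the left side of the homotopy formula is zero, which forces type
   [xtype i]. *)
have xB i : xtype i B.
  have := ddop_nabla_self i B; have /setP/(_ i) := I0; have /setP/(_ i) := J0.
  rewrite !inE mB ddopE => /negbFE/eqP -> /negbFE/eqP ->; rewrite end0 /ddop !pd0 addr0.
  move/(congr1 (fun f : O => f B)); rewrite !superO_coordE xbasE eqxx mulr1.
  by case: (xtype i B) => //= /eqP; rewrite eq_sym oner_eq0.
have BE := xtypeP xB (last_notin u).
set A := [set i | _] in BE; have uE : u = ~: A.
  by apply/setP => i; rewrite !inE negbK lift_in.
exists A; last by rewrite mB BE -XmonE.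
apply/eqP; rewrite -zd_X -BE -uE /= eq_sym -subr_eq0; exact/eqP.
Qed.

Lemma zeta_X_in_S5 A : zdX A = c -> DKO (zeta ** X A) \in <<S5 p t lam>>%VS.
Proof.
move=> zA; have : DKO (X A ** zeta) \in <<S5 p t lam>>%VS.
  apply/memv_span/mapP; exists ((XB A).1, ~: A); last by rewrite XmonE.
  rewrite mem_filter mem_enum andbT /=.
  have mB : xmon2 F p t (fun i => (XB A).1 i) (~: A) = X A by rewrite XmonE.
  apply/and3P; split; last by rewrite zd_X zA subrr.
    by apply/eqP/setP => i; rewrite !inE mB ddopE ddop_X eqxx.
  by apply/eqP/setP => i; rewrite !inE mB nabla_X eqxx.
rewrite X_zeta linearZ /= => /(memvZ ((-1) ^+ odd #|~: A|)).
by rewrite scalerA -expr2 sqrr_sign scale1r.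
Qed.

Lemma mem_frakS (l : int) (k : nat) : (k \in frakS n lam l) =
  (k <= n)%N && (c - n%:R + (2 * k)%:R + l%:~R == 0).
Proof. by rewrite mem_filter mem_iota add0n leq0n ltnS andbC. Qed.

Lemma XfamilyP D : D \in Xfamily p t lam ->
  exists2 A : {set 'I_n}, zdX A = c + 2%:R & D = DKO (X A).
Proof.
case/allpairsPdep => r [A [+ + ->]].
rewrite mem_frakS mem_enum inE => /andP[_ /eqP rE] /eqP Ar.
exists A => //; rewrite Ar; apply/eqP; rewrite -subr_eq0 -oppr_eq0 -rE; apply/eqP; ring.
Qed.

Lemma X_in_Xfamily A : zdX A = c + 2%:R -> DKO (X A) \in <<Xfamily p t lam>>%VS.
Proof.
move=> zA; apply: memv_span; apply/allpairsPdep; exists #|A|, A; split=> //.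
  have An : (#|A| <= n)%N by have := max_card (mem A); rewrite card_ord.
  rewrite mem_frakS An /=; apply/eqP.
  have -> : c = zdX A - 2%:R by rewrite zA addrK.
  ring.
by rewrite mem_enum inE.
Qed.

Lemma frakS0P : reflect (exists A, zdX A = c) (frakS n lam 0 != [::]).
Proof.
apply: (iffP idP) => [|[A zA]].
  case E: (frakS n lam 0) => [//|k s] _.
  have : k \in frakS n lam 0 by rewrite E inE eqxx.
  rewrite mem_frakS => /andP[kn /eqP kE].
  (* Any set with k elements would do; the initial segment is taken. *)
  exists [set i : 'I_n | (i < k)%N].
  have -> : #|[set i : 'I_n | (i < k)%N]| = k.
    have wI : injective (widen_ord kn) by move=> i l /(congr1 val) /= /ord_inj.
    rewrite -[RHS](card_ord k) -(card_imset _ wI).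
    apply: eq_card => i; rewrite inE; apply/idP/imsetP => [ik|[l _ ->]] /=.
      by exists (Ordinal ik) => //; apply: ord_inj.
    exact: ltn_ord.
  by apply/eqP; rewrite -subr_eq0 -oppr_eq0 -kE; apply/eqP; ring.
suff : #|A| \in frakS n lam 0 by case: (frakS n lam 0).
have An : (#|A| <= n)%N by have := max_card (mem A); rewrite card_ord.
rewrite mem_frakS An -zA; apply/eqP; ring.
Qed.

(* The Berezin integral: the coefficient of the monomial of highest degree, which
   kills all partial derivatives. *)
Definition intg a : F := a ([ffun i => Ordinal (top_lt i)] : mindex p t, setT).

Lemma intg_pd r a : intg (pd r a) = 0.
Proof.
case: r => [i|j]; first by apply: pd_inl_coord; rewrite /= ffunE.
by apply: pd_inr_coord; rewrite inE.
Qed.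

Lemma intg_eul a : intg (eul a) = 0.
Proof.
rewrite /intg eul_coord (eq_bigr (fun i => top i)) => [|i _]; last by rewrite ffunE.
rewrite (_ : [set i | _] = setT) ?cardsT ?card_ord ?sum_top ?mul0r //.
by apply/setP => i; rewrite !inE.
Qed.

Lemma intgD a b : intg (a + b) = intg a + intg b.
Proof. by rewrite /intg superO_coordE. Qed.

Lemma intgZ k a : intg (k *: a) = k * intg a.
Proof. by rewrite /intg superO_coordE. Qed.

Lemma intgN a : intg (- a) = - intg a.
Proof. by rewrite /intg superO_coordE. Qed.

Lemma intg_sum (I : finType) (f : I -> O) : intg (\sum_i f i) = \sum_i intg (f i).
Proof. by rewrite /intg sum_ffunE. Qed.

Lemma intg_pd_mul r a b : intg (pd r a ** b) = - intg (sg (mu r) a ** pd r b).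
Proof. by apply/eqP; rewrite -addr_eq0 -intgD -pd_mul intg_pd. Qed.

Lemma intg_eul_mul a b : intg (eul a ** b) = - intg (a ** eul b).
Proof. by apply/eqP; rewrite -addr_eq0 -intgD -eul_mul intg_eul. Qed.

Lemma intg_Delta_mul a b : intg (Delta a ** b) = intg (sg true a ** Delta b).
Proof.
rewrite !Delta_dd omul_suml omul_sumr !intg_sum; apply: eq_bigr => i _.
rewrite /ddop intg_pd_mul sg0 intg_pd_mul opprK; congr (intg (_ ** _)).
by rewrite pd_comm /= scale1r.
Qed.

(* The adjoint of cdiv (c + 2) is therefore cdiv c exactly when c = -1. *)
Lemma intg_cdiv_mul k (k' : F) a b : k' = - k ->
  intg (cdiv k a ** b) = intg (sg true a ** cdiv k' b).
Proof.
move=> kk; have E := cdivE k a; have E' := cdivE k' b.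
apply: (eq_trans (congr1 (fun f => intg (f ** b)) E)); apply/esym.
apply: (eq_trans (congr1 (fun f => intg (sg true a ** f)) E')); rewrite {}kk /=.
rewrite !(omulDl, omulDr, omulNl, omulNr, omulZl, omulZr) !(intgD, intgN, intgZ).
rewrite intg_Delta_mul intg_eul_mul !intg_pd_mul pd_eul_last; ring.
Qed.

Lemma intg_free a b : pd z a = 0 -> pd z b = 0 -> intg (a ** b) = 0.
Proof.
move=> za zb; apply: (@pd_inr_eq0 ord_max); last by rewrite inE.
by rewrite -[inr _]/z pd_mul za zb omul0l omul0r addr0.
Qed.

(** Without X of weight c the terms z X in [cdiv_split] are absent. *)
Lemma cdiv_split_free a : (forall A, zdX A != c) -> cdiv c a = 0 ->
  exists h f, [/\ pd z f = 0, cdiv c f = 0 & a = cdiv (c + 2%:R) h + f].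
Proof.
move=> noX ka; have [g [b [hg zb kf zf]]] := cdiv_split ka.
move: kf zf; rewrite big1 ?subr0 => [kf zf|A _]; last first.
  by have [->|/hg/eqP] := eqVneq (g A) 0; rewrite ?scale0r // (negPf (noX A)).
exists (- (zeta ** b)), (a + cdivz b); split=> //.
by rewrite (endN (cdiv _)) addrC addrK.
Qed.

(** Write [a] as an image of [cdiv (c + 2)] plus a function free of z. The image part integrates to
    zero by adjunction, as c = -(c + 2). The same is then done for [b], leaving a product free of
    z. *)
Lemma intg_mul0 d a b : c + 1 = 0 -> (forall A, zdX A != c) ->
  hom d b -> cdiv c a = 0 -> cdiv c b = 0 -> intg (a ** b) = 0.
Proof.
move=> c1 noX hb ka kb; have cE : c = - (c + 2%:R).
  by apply/eqP; rewrite -subr_eq0 opprK addrA -[2%:R]/(1 + 1) [c + c + _]addrACA c1 addr0.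
have adj h f : cdiv c f = 0 -> intg (cdiv (c + 2%:R) h ** f) = 0.
  by move=> kf; rewrite (intg_cdiv_mul _ _ cE) kf omul0r /intg superO_coordE.
have [h [f [zf kf ->]]] := cdiv_split_free noX ka.
(* Supercommutativity moves [b] to the front, where it can be split in turn. *)
rewrite omulDl intgD adj // add0r -[f](sgK d) -(scomm _ hb).
have ksf : cdiv c (sg d f) = 0 by rewrite cdiv_sg kf end0 scaler0.
have [h' [f' [zf' _ ->]]] := cdiv_split_free noX kb.
rewrite omulDl intgD adj // add0r intg_free // -[RHS](scaler0 _ ((-1) ^+ d)).
by rewrite -(end0 (sg d)) -zf sg_pd andbT scalerA -expr2 sqrr_sign scale1r.
Qed.

End Decomposition.

Section Main.

Implicit Types (i l : 'I_n) (j : 'I_n.+1) (A : {set 'I_n}) (Q : pred (mon p t)).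

(** * The element G and the coefficient at its leading monomial *)

Section TopElement.

Variable i1 : 'I_n.
Local Notation m := (xmon2 F p t (fun i => top i - unit_index i1 i)%N (~: [set i1])).

Lemma subtop_lt i : (top i - unit_index i1 i < p ^ t i)%N.
Proof. exact: leq_ltn_trans (leq_subr _ _) (top_lt i). Qed.

(* The leading monomial of Gelt. *)
Definition G_mon : mon p t :=
  ([ffun i => Ordinal (subtop_lt i)] : mindex p t, ~: [set lift ord_max i1]).

Lemma G_mon1 i : G_mon.1 i = (top i - unit_index i1 i)%N :> nat.
Proof. by rewrite ffunE. Qed.

Lemma last_in_G_mon : ord_max \in G_mon.2.
Proof. by rewrite !inE neq_lift. Qed.

Lemma xtype_G_mon : ~~ xtype i1 G_mon.
Proof.
rewrite /xtype G_mon1 /unit_index !inE !eqxx /=.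
by have := pos_top i1; case: (top i1) => //= q _; rewrite subn1 /= neq_ltn ltnSn.
Qed.

(** The only monomial that [ddop i1] sends to a multiple of [G_mon] is the full one, containing
    z. *)
Lemma ddop_G_mon : exists2 k, k != 0 & forall a, ddop i1 a G_mon = k * intg a.
Proof.
exists (osign F [set lift ord_max i1] setT); first exact: osign_neq0.
move=> a; elim/superO_ind: a => [|k a b ha hb|C].
- by rewrite /ddop !pd0 /intg !superO_coordE mulr0.
- by rewrite /ddop !(pdD, pdZ) !superO_coordE ha hb /intg !superO_coordE; ring.
have E : ddop i1 (xbas F C) =
    ((lift ord_max i1 \in C.2)%:R * osign F [set lift ord_max i1] C.2
    * (0 < C.1 i1)%N%:R) *: xm (fun l => C.1 l - unit_index i1 l)%N (C.2 :\ lift ord_max i1).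
  by rewrite /ddop /xbas /= pd_inr_xmon pdZ pd_inl_xmon // scalerA.
rewrite E superO_coordE /intg xbasE.
set Bt := (_, _); have [<-|nC] := eqVneq Bt C.
  rewrite inE ffunE pos_top mul1r !mulr1 ffunE (_ : [forall i, _] && _ = true) ?mulr1 //.
  apply/andP; split; first by apply/forallP => i; rewrite G_mon1 ffunE.
  by rewrite /= setTD.
rewrite mulr0; apply/eqP/negPn/negP; rewrite !mulf_eq0 !negb_or.
move=> /andP[/andP[/andP[iC _] C0]].
case/xmon_coord => C1 C2; case/eqP: nC.
have {}iC : lift ord_max i1 \in C.2 by case: (_ \in _) iC => //; rewrite eqxx.
have {}C0 : (0 < C.1 i1)%N by case: (0 < _)%N C0 => //; rewrite eqxx.
case: C C1 C2 iC C0 {E} => al u /= C1 C2 iu al0; congr pair.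
  apply/ffunP => i; apply: ord_inj; rewrite ffunE /=; have := C1 i; rewrite ffunE /=.
  rewrite /unit_index; case: eqP => [->|_]; last by rewrite !subn0.
  by have := pos_top i1; lia.
by rewrite -(setD1K iu) -C2 setUCr.
Qed.

(** The other summands of [Delta] miss [G_mon], whose exponents away from i1 are maximal, and the
    part with [pd z] misses it because [G_mon] contains z. *)
Lemma cdiv_G_mon : exists2 k, k != 0 & forall k' a, cdiv k' a G_mon = k * intg a.
Proof.
have [k k0 E] := ddop_G_mon; exists k => // k' a.
rewrite cdivE !superO_coordE eul_coord pd_inr_coord ?last_in_G_mon // -E.
rewrite Delta_dd sum_ffunE (bigD1 i1) //= big1 => [|l li]; first by ring.
by rewrite /ddop; apply: pd_inl_coord; rewrite G_mon1 /unit_index (negPf li) subn0.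
Qed.

Lemma cdivz_top_G_mon : cdivz topO G_mon != 0.
Proof.
have [k k0 E] := cdiv_G_mon; rewrite E mulf_neq0 // /xvar mul_xmon /intg superO_coordE.
rewrite /osgn disjoint1 last_notin /mulbin big1 ?mulr1 => [|i _]; last by rewrite bin0.
rewrite mulf_neq0 ?osign_neq0 // ffunE (_ : [forall i, _] && _ = true) ?oner_eq0 //.
apply/andP; split; first by apply/forallP => i; rewrite ffunE.
apply/eqP/setP => j; rewrite !inE; case: (unliftP ord_max j) => [i ->|->].
  by rewrite lift_in inE orbT.
by rewrite eqxx.
Qed.

Lemma nabla_m : exists2 k, k != 0 & nabla i1 m = k *: topO.
Proof.
set u := [set lift ord_max i | i in ~: [set i1]].
exists (osign F [set lift ord_max i1] u); first exact: osign_neq0.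
rewrite nablaE up_xmon /xvar mul_xmon /osgn disjoint1 lift_in !inE eqxx /mulbin.
rewrite big1 ?mulr1 => [|i _]; last by rewrite bin0.
congr (_ *: _); apply: xmon_congr => [i|].
  by rewrite add0n subnK // /unit_index; case: eqP => // ->; apply: pos_top.
apply/setP => j; rewrite !inE; case: (unliftP ord_max j) => [i ->|->].
  by rewrite !lift_in !inE (inj_eq (@lift_inj _ _)) orbN.
by rewrite !(negPf (last_notin _)) (negPf (neq_lift _ _)).
Qed.

(** The homotopy formula identifies the factor A of G as Delta-exact; by [nabla_m] it is
    [Delta topO] up to a sign. *)
Lemma Delta_nabla_m : Delta (nabla i1 m) =
  m - \sum_(i in Iset F p t (fun i => top i - unit_index i1 i)%N (~: [set i1]))
        Gam F p t i i1 m.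
Proof.
pose B : mon p t := (G_mon.1, [set lift ord_max i | i in ~: [set i1]]).
have mB : m = xbas F B by apply: xmon_congr => // i; rewrite G_mon1.
have xB : ~~ xtype i1 B.
  have := xtype_G_mon; rewrite /xtype [B.2]/(snd _) lift_in -[B.1]/G_mon.1.
  by rewrite !inE !eqxx.
have := Delta_nabla i1 B; rewrite -mB xB scale1r => /(canRL (addrK _)) ->.
congr (_ - _); rewrite Delta_dd linear_sum [RHS]big_mkcond; apply: eq_bigr => i _ /=.
have -> : Gam F p t i i1 m = nabla i1 (ddop i m) by rewrite -ddopE /Gam comp_lfunE.
rewrite inE ddopE; case: eqP => //= ->; exact: end0.
Qed.

Lemma zd_m : (zd (fun i => top i - unit_index i1 i)%N (~: [set i1]))%:R = - 2%:R :> F.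
Proof.
apply/eqP; rewrite -addr_eq0 -natrD -[X in _ == X]sum_top; apply/eqP; congr _%:R.
rewrite /zd cardsC1 card_ord (bigD1 i1) //= [in RHS](bigD1 i1) //=.
rewrite {1}/unit_index eqxx (eq_bigr (fun i => top i)) => [|i ii]; last first.
  by rewrite /unit_index (negPf ii) subn0.
have := pos_top i1; have := ltn_ord i1; lia.
Qed.

Lemma hom_Delta e a : hom e a -> hom (~~ e) (Delta a).
Proof.
by move=> ha; rewrite Delta_dd; apply: hom_sum => i _; apply: hom_pd (hom_pd _ ha).
Qed.

Lemma hom_top : hom (odd n) topO.
Proof.
have := hom_xmon top [set lift ord_max i | i in [set: 'I_n]].
by rewrite card_imset ?cardsT ?card_ord //; apply: lift_inj.
Qed.

Lemma GeltE : exists2 k, k != 0 & Gelt p t lam i1 = k *: DKO (cdivz topO).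
Proof.
have [k k0 kE] := nabla_m.
have uE : odd #|~: [set i1]| = ~~ odd n.
  have n0 : (0 < n)%N := leq_ltn_trans (leq0n i1) (ltn_ord i1).
  by rewrite cardsC1 card_ord -[in RHS](prednK n0) /= negbK.
exists (- (-1) ^+ (~~ odd n) * k).
  by rewrite mulf_neq0 ?oppr_eq0 ?signr_eq0.
have lZ q a : q *: DKO a = DKO (q *: a) by rewrite linearZ.
(* By [zd_m] the factor n lambda - zd in B is c + 2, the scalar in [cdivz_top]; moving z in front of
   [Delta topO] accounts for the sign. *)
rewrite /Gelt -Delta_nabla_m zd_m -signr_odd uE kE (endZ Delta) omulZl lZ; congr (DKO _).
rewrite (scomm_hom (hom_Delta hom_top) (hom_xvar z)) andbT cdivz_top.
by module_ring.
Qed.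

End TopElement.

(** * Inclusions between the two sides, and directness of the sum *)

Local Notation g2 := (SKO2 p t lam).

(** Each of the three alternatives provides [cdivz topO], the last generator that [cdiv_in] asks
    for. *)
Lemma SKO2_sub (V : {vspace 'End(O)}) (i1 : 'I_n) :
    (g1 <= V)%VS -> (<<S5 p t lam>> <= V)%VS -> (<<Xfamily p t lam>> <= V)%VS ->
    [\/ c + 1 != 0, frakS n lam 0 != [::] | DKO (cdivz topO) \in V] ->
  (g2 <= V)%VS.
Proof.
move=> g1V sV xV hV; apply/subvP => D /SKO2P[a ka ->].
have XV A : zdX A = c + 2%:R -> DKO (X A) \in V.
  by move=> zA; apply: (subvP xV); apply: X_in_Xfamily.
have zXV A : zdX A = c -> DKO (zeta ** X A) \in V.
  by move=> zA; apply: (subvP sV); apply: zeta_X_in_S5.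
apply: (cdiv_in i1 g1V XV _ zXV ka).
case: hV => [c1|/frakS0P[A zA]|//]; first exact: (cdivz_top_in i1 g1V XV c1).
exact: (cdivz_top_in_X g1V zA).
Qed.

Lemma derived_in : (g1 <= g2)%VS.
Proof. by apply: derived_sub => e d a b _ _ _ _; rewrite mem_SKO2 cdiv_cdiv. Qed.

Lemma S5_in : (<<S5 p t lam>> <= g2)%VS.
Proof.
apply/span_subvP => D /S5P[A zA ->].
by rewrite X_zeta linearZ memvZ // mem_SKO2 cdiv_zeta_X.
Qed.

Lemma Xfamily_in : (<<Xfamily p t lam>> <= g2)%VS.
Proof.
apply/span_subvP => D /XfamilyP[A _ ->].
by rewrite mem_SKO2 cdiv_free ?pd_last_X // Delta_X.
Qed.

Lemma S5_supported : (<<S5 p t lam>> <= supported S_mon)%VS.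
Proof.
apply/span_subvP => D /S5P[A zA ->].
rewrite X_zeta linearZ memvZ //; apply: mem_supported; exact: zeta_X_coord.
Qed.

Lemma Xfamily_supported : (<<Xfamily p t lam>> <= supported X_mon)%VS.
Proof.
by apply/span_subvP => D /XfamilyP[A zA ->]; apply: mem_supported => B; apply: X_coord.
Qed.

Lemma directv_supported (U W : {vspace 'End(O)}) Q :
  (U <= vanishing Q)%VS -> (W <= supported Q)%VS -> (U :&: W)%VS = 0%VS.
Proof.
move=> UQ WQ; apply/eqP; rewrite -subv0; apply/subvP => D.
rewrite memv_cap memv0 => /andP[/(subvP UQ) DU /(subvP WQ) DW].
by apply/eqP; apply: vanishing_supported DU DW.
Qed.

Lemma S_mon_notin_X B : S_mon B -> ~~ X_mon B.
Proof. by rewrite /S_mon /X_mon => /andP[-> ->]. Qed.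

(** S_5 lives on monomials where the derived algebra vanishes, and the X family on monomials where
    both vanish. *)
Lemma directv_S_X : directv (g1 + <<S5 p t lam>> + <<Xfamily p t lam>>).
Proof.
rewrite directv_addE; apply/and3P; split; last 2 first.
- by rewrite directvE.
- rewrite /=; apply/eqP/(@directv_supported _ _ X_mon); last exact: Xfamily_supported.
  rewrite subv_add derived_X_mon; apply: subv_trans S5_supported _.
  exact: supported_vanishing S_mon_notin_X.
by apply/directv_addP; apply: directv_supported derived_S_mon S5_supported.
Qed.

(** * The exceptional case: G lies outside the other summands *)

Section Exceptional.

Variable i1 : 'I_n.
Hypotheses (c1 : c + 1 = 0) (noX : frakS n lam 0 = [::]).
Local Notation G_mon := (G_mon i1).

Lemma noX_c A : zdX A != c.
Proof.
apply/eqP => zA; have /frakS0P : exists A', zdX A' = c by exists A.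
by rewrite noX.
Qed.

(** The coefficient of [cdiv (c + 2) (a b)] at [G_mon] is a multiple of the integral of a b, which
    is zero by [intg_mul0]. *)
Lemma derived_vanishing_G_mon : (g1 <= vanishing (pred1 G_mon))%VS.
Proof.
have [k k0 E] := cdiv_G_mon i1.
apply: derived_sub => e d a b _ hb ka kb; apply/mem_vanishing => B /eqP ->.
by rewrite E (intg_mul0 c1 noX_c hb ka kb) mulr0.
Qed.

Lemma xtype_neq_G_mon B : [forall i, xtype i B] -> ~~ pred1 G_mon B.
Proof.
move=> /forallP xB; apply/eqP => E; have := xB i1; rewrite E.
exact/negP/xtype_G_mon.
Qed.

Lemma sum_vanishing_G_mon :
  (g1 + <<S5 p t lam>> + <<Xfamily p t lam>> <= vanishing (pred1 G_mon))%VS.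
Proof.
rewrite !subv_add derived_vanishing_G_mon /=; apply/andP; split.
  apply: subv_trans S5_supported (supported_vanishing _) => B /andP[xB _].
  exact: xtype_neq_G_mon.
apply: subv_trans Xfamily_supported (supported_vanishing _) => B /and3P[xB _ _].
exact: xtype_neq_G_mon.
Qed.

Lemma directv_S_X_G :
  directv (g1 + <<S5 p t lam>> + <<Xfamily p t lam>> + <[Gelt p t lam i1]>).
Proof.
rewrite directv_addE; apply/and3P; split; first exact: directv_S_X.
  by rewrite directvE.
rewrite /= -subv0; apply/subvP => D; rewrite memv_cap => /andP[/(subvP sum_vanishing_G_mon)].
have [k k0 ->] := GeltE i1; move=> + /vlineP[q DE]; rewrite {}DE scalerA memv0.
have lZ k1 a : k1 *: DKO a = DKO (k1 *: a) by rewrite linearZ.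
rewrite lZ => /mem_vanishing/(_ G_mon (eqxx _))/eqP; rewrite superO_coordE mulf_eq0.
by rewrite (negPf (cdivz_top_G_mon i1)) orbF => /eqP ->; rewrite scale0r linear0.
Qed.

End Exceptional.

End Main.

End OddContact.

Theorem theorem2p6 (F : fieldType) (p : nat) (hp : p \in [pchar F]) (hp3 : (3 < p)%N)
    (n : nat) (hn : (2 < n)%N) (t : 'I_n -> nat) (ht : forall i, (0 < t i)%N)
    (lam : F) :
  let g2 : {vspace 'End(superO F p t)} := SKO2 p t lam in
  let g1 : {vspace 'End(superO F p t)} := bracketv g2 g2 in
  let i1 : 'I_n := Ordinal (ltnW (ltnW hn)) in
  (n%:R * lam + 1 != 0 \/ frakS n lam 0 != [::] ->
     g2 = (g1 + <<S5 p t lam>> + <<Xfamily p t lam>>)%VS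
     /\ directv (g1 + <<S5 p t lam>> + <<Xfamily p t lam>>))
  /\
  (n%:R * lam + 1 = 0 /\ frakS n lam 0 = [::] ->
     g2 = (g1 + <<S5 p t lam>> + <<Xfamily p t lam>> + <[Gelt p t lam i1]>)%VS
     /\ directv (g1 + <<S5 p t lam>> + <<Xfamily p t lam>> + <[Gelt p t lam i1]>)).
Proof.
move=> g2 g1 i1.
have h2 : 2%:R != 0 :> F by rewrite -(dvdn_pcharf hp) gtnNdvd // ltnW.
have WV := addvSl (g1 + <<S5 p t lam>> + <<Xfamily p t lam>>)%VS <[Gelt p t lam i1]>%VS.
have [s1 s2 s3] : [/\ (g1 <= g1 + <<S5 p t lam>> + <<Xfamily p t lam>>)%VS,
    (<<S5 p t lam>> <= g1 + <<S5 p t lam>> + <<Xfamily p t lam>>)%VS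
  & (<<Xfamily p t lam>> <= g1 + <<S5 p t lam>> + <<Xfamily p t lam>>)%VS].
  split; last exact: addvSr.
    exact: subv_trans (addvSl _ _) (addvSl _ _).
  exact: subv_trans (addvSr _ _) (addvSl _ _).
have W2 : (g1 + <<S5 p t lam>> + <<Xfamily p t lam>> <= g2)%VS.
  by rewrite !subv_add derived_in // S5_in // Xfamily_in.
split=> [hyp | [c1 noX]]; split.
- apply/eqP; rewrite eqEsubv W2 andbT; apply: (SKO2_sub hp h2 ht i1 s1 s2 s3).
  by case: hyp => h; [apply: Or31 | apply: Or32].
- exact: directv_S_X.
(* In the exceptional case G itself supplies [cdivz topO], as the two are proportional. *)
- have [k k0 GE] := GeltE lam hp h2 ht i1.
  have Gk : D_KO F p t (cdivz lam (topO F p t)) = k^-1 *: Gelt p t lam i1.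
    by rewrite GE scalerA mulVf // scale1r.
  apply/eqP; rewrite eqEsubv subv_add W2 /=; apply/andP; split.
    apply: (SKO2_sub hp h2 ht i1 (subv_trans s1 WV) (subv_trans s2 WV) (subv_trans s3 WV)).
    by apply: Or33; rewrite Gk memvZ // (subvP (addvSr _ _)) // memv_line.
  by rewrite -memvE GE memvZ // mem_SKO2 // cdiv_cdivz.
exact: directv_S_X_G.
Qed.
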